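(* Let $k\ge 2$ be an integer and let $G$ be a connected graph of order $n\ge 2k+2$ with minimum degree $\delta(G)\ge k$. Then the following statements hold. (i) If $n\ge 2k+3$ and $\rho_D(G)\le\rho_D(F_{n,k})$, then $\tau(G)\ge k$, unless $G\cong F_{n,k}$. (ii) If $n=2k+2$ and $\rho_D(G)\le n+1$, then $\tau(G)\ge k$, unless $G\cong H$ for some $H\in\mathcal{F}_n$.
   Context: All graphs are finite, undirected and simple. The order of a graph is its number of vertices. $\tau(G)$ is the maximum number of pairwise edge-disjoint spanning trees contained in $G$. For a connected graph $G$ with vertices $v_1,\dots,v_n$, the distance matrix $D(G)$ is the $n\times n$ matrix whose $(i,j)$ entry is the distance $d_G(v_i,v_j)$ (length of a shortest path), and $\rho_D(G)$, the distance spectral radius, is its largest eigenvalue. $K_m$ and $C_m$ denote the complete graph and the cycle on $m$ vertices, $\cup$ is disjoint union, and $\overline{G}$ is the complement of $G$. For $n\ge 2k+3$, the graph $F_{n,k}$ is defined as follows: choose two disjoint subsets $S,T\subseteq V(K_{n-2})$ with $|S|=|T|=k-1$; $F_{n,k}$ is obtained from $K_{n-2}$ by adding two new vertices $u$ and $v$, the edge $uv$, all edges joining $u$ to the vertices of $S$, and all edges joining $v$ to the vertices of $T$. For $n=2k+2\ge 6$, $\mathcal{F}_n=\{\overline{C_{n_1}\cup\cdots\cup C_{n_s}}: s\ge 1,\ n_i\ge 3,\ \sum_{i=1}^{s}n_i=n\}$, where $s,n_1,\ldots,n_s$ are integers; that is, the family of graphs obtained from $K_n$ by deleting the edges of vertex-disjoint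 cycles that together cover all its vertices. *)

(* Defs.v *)
From HB Require Import structures.
From mathcomp Require Import all_boot all_order all_algebra.
From mathcomp Require Import all_classical all_reals.

Set Implicit Arguments.
Unset Strict Implicit.
Unset Printing Implicit Defensive.

Import Order.TTheory GRing.Theory Num.Theory.

Local Open Scope nat_scope.

Record sgraph := SGraph {
  vertex :> finType;
  adj : rel vertex;
  adj_sym : symmetric adj;
  adj_irr : irreflexive adj }.

Definition isomorphic (G H : sgraph) : Prop :=
  exists2 f : G -> H, bijective f & forall x y, adj (f x) (f y) = adj x y.

Definition gconnected (G : sgraph) : Prop := forall x y : G, connect (@adj G) x y.

(* The default value #|G| of the minimum exceeds every degree, so it only
   matters for the empty graph. *)
Definition min_degree (G : sgraph) : nat :=
  \big[minn/#|G|]_(x : G) #|[set y | adj x y]|.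

Definition has_path (G : sgraph) (x y : G) (d : nat) : bool :=
  [exists p : d.-tuple G,
    [&& path (@adj G) x p, uniq (x :: p) & last x p == y]].

(* A path has fewer than #|G| edges; #|G| is a junk value for vertices in
   different components. *)
Definition dist (G : sgraph) (x y : G) : nat :=
  \big[minn/#|G|]_(d < #|G| | has_path x y d) d.

Definition distmx (R : realType) (G : sgraph) : 'M[R]_#|G| :=
  \matrix_(i, j) ((dist (enum_val i) (enum_val j))%:R)%R.

(* The set of eigenvalues is finite and, the matrix being real symmetric, it is
   nonempty as soon as G is; its supremum is then its largest element. *)
Definition dist_radius (R : realType) (G : sgraph) : R :=
  sup [set a : R | eigenvalue (distmx R G) a]%classic.

Definition edges (G : sgraph) : {set {set G}} :=
  [set [set p.1; p.2] | p : G * G & adj p.1 p.2].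

Definition edge_rel (V : finType) (F : {set {set V}}) : rel V :=
  [rel x y | [set x; y] \in F].

Definition acyclic (V : finType) (r : rel V) : bool :=
  [forall m : 'I_#|V|.+1, forall c : m.-tuple V,
    ~~ [&& 3 <= m, uniq c & cycle r c]].

Definition spanning_tree (G : sgraph) (F : {set {set G}}) : bool :=
  [&& F \subset edges G,
      [forall x, forall y, connect (edge_rel F) x y]
    & acyclic (edge_rel F)].

(* Spanning trees of a graph with at least two vertices are nonempty edge sets,
   so edge-disjoint ones are distinct and a set of trees (rather than a list)
   loses nothing. *)
Definition tau (G : sgraph) : nat :=
  \max_(P : {set {set {set G}}} |
        [forall F in P, spanning_tree F] && finset.trivIset P) #|P|.

(* F_{n,k} for given S and T: the vertices of K_m (with m = n - 2)
    are the inl i, the vertex u is inr true and v is inr false. *)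

Section FGraph.
Variables (m : nat) (S T : {set 'I_m}).

Definition F_adj (x y : 'I_m + bool) : bool :=
  match x, y with
  | inl i, inl j => i != j
  | inl i, inr b | inr b, inl i => i \in (if b then S else T)
  | inr b, inr c => b != c
  end.

Lemma F_adj_sym : symmetric F_adj.
Proof. by move=> [i|b] [j|c] //=; exact: (congr1 negb (eq_sym _ _)). Qed.

Lemma F_adj_irr : irreflexive F_adj.
Proof. by move=> [i|b] /=; rewrite eqxx. Qed.

Definition F_graph : sgraph := SGraph F_adj_sym F_adj_irr.
End FGraph.

Section Complement.
Variable G : sgraph.

Definition compl_adj (x y : G) : bool := (x != y) && ~~ adj x y.

Lemma compl_adj_sym : symmetric compl_adj.
Proof. by move=> x y; rewrite /compl_adj eq_sym adj_sym. Qed.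

Lemma compl_adj_irr : irreflexive compl_adj.
Proof. by move=> x; rewrite /compl_adj eqxx. Qed.

Definition complement : sgraph := SGraph compl_adj_sym compl_adj_irr.
End Complement.

Section DisjointUnion.
Variables (I : finType) (G : I -> sgraph).

(* tagged_as x y is tagged y, transported to the component of x. *)
Definition dunion_adj (x y : {i : I & G i}) : bool :=
  (tag x == tag y) && adj (tagged x) (tagged_as x y).

Lemma dunion_adj_sym : symmetric dunion_adj.
Proof.
move=> [i x] [j y]; rewrite /dunion_adj eq_sym /=; case: eqP => //= eq_ji.
by case: _ / eq_ji x => x; rewrite !tagged_asE adj_sym.
Qed.

Lemma dunion_adj_irr : irreflexive dunion_adj.
Proof. by move=> [i x]; rewrite /dunion_adj eqxx tagged_asE adj_irr. Qed.

Definition dunion : sgraph := SGraph dunion_adj_sym dunion_adj_irr.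
End DisjointUnion.

Section Cycle.
Variable m : nat.

(* The conjunct x != y only matters for m = 1. *)
Definition cycle_adj (x y : 'I_m) : bool :=
  (x != y) && ((y == ordS x) || (x == ordS y)).

Lemma cycle_adj_sym : symmetric cycle_adj.
Proof. by move=> x y; rewrite /cycle_adj eq_sym orbC. Qed.

Lemma cycle_adj_irr : irreflexive cycle_adj.
Proof. by move=> x; rewrite /cycle_adj eqxx. Qed.

Definition cycle_graph : sgraph := SGraph cycle_adj_sym cycle_adj_irr.
End Cycle.

Inductive co_cycles (n : nat) : sgraph -> Prop :=
  CoCycles (s : nat) (c : 'I_s -> nat) of
    1 <= s & (forall i, 3 <= c i) & \sum_(i < s) c i = n :
    co_cycles n (complement (dunion (fun i => cycle_graph (c i)))).

(* Main.v *)
(* Suppose that G has no k edge-disjoint spanning trees.  By the theorem of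
   Nash-Williams and Tutte some partition of the vertices into p parts is
   crossed by fewer than k(p - 1) edges.  Counting the missing edges according
   to the sizes of the parts, the minimum degree condition leaves three
   possibilities: two adjacent vertices u, v of degree k (two singleton parts
   out of three), at least 3n - 3k - 5 missing edges, or the missing edges
   forced by the partition into singletons.

   A pair of nonadjacent vertices is at distance at least 2, so every missing
   edge raises the Rayleigh quotient of D(G).  With the constant test vector,
   n = 2k + 2 and radius at most n + 1 force equality everywhere: the
   complement is 2-regular, hence a union of cycles.  For n >= 2k + 3 the same
   vector excludes many missing edges, the radius of F_{n,k} being less than
   n + 5 - (6k + 10)/n.  When u, v exist, the Perron vector of F_{n,k}, put on
   V(G) according to adjacency with u and v, has the Rayleigh quotient of
   F_{n,k} or more; equality makes it an eigenvector of D(G), so u and v have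
   no common neighbour, all other pairs are adjacent, and G is F_{n,k}. *)

Require Import Defs.
From HB Require Import structures.
From mathcomp Require Import all_boot all_order all_algebra.
From mathcomp Require Import all_classical all_reals.
From mathcomp Require Import complex.
From mathcomp Require Import ring lra zify.

Set Implicit Arguments.
Unset Strict Implicit.
Unset Printing Implicit Defensive.

Import Order.TTheory GRing.Theory Num.Theory.

Local Open Scope nat_scope.

(** * Spectral theorem, Rayleigh quotients and positive test vectors *)

Section Rayleigh.
Local Open Scope ring_scope.
Local Open Scope sesquilinear_scope.

(** Over [R[i]] the matrix is Hermitian, hence unitarily diagonalizable with real spectrum. The
    eigenvectors, the rows of [Q], stay complex, but an eigenvalue of the extended matrix that lies
    in [R] is one of [A] itself. *)
Lemma real_spectral (R : realType) (n : nat) (A : 'M[R]_n) : A^T = A ->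
  exists (Q : 'M[R[i]]_n) (l : 'I_n -> R),
    [/\ Q \is unitarymx, forall i, eigenvalue A (l i) &
        map_mx (real_complex R) A =
        Q^t* *m diag_mx (\row_i real_complex R (l i)) *m Q].
Proof.
move=> A_sym; set B := map_mx _ A.
have B_herm : B \is hermsymmx.
  apply: realsym_hermsym.
    by apply/is_hermitianmxP; rewrite expr0 scale1r map_mx_id // map_trmx A_sym.
  by apply/mxOverP => i j; rewrite mxE complex_real.
have l_real := hermitian_spectral_diag_real B_herm.
have /orthomx_spectralP B_eq := hermitian_normalmx B_herm.
have Q_unitary := spectral_unitarymx B.
pose l i := complex.Re (spectral_diag B 0 i).
have lE i : real_complex R (l i) = spectral_diag B 0 i.
  by rewrite RRe_real //; exact: (mxOverP l_real).
exists (spectralmx B), l; split=> // [i|]; last first.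
  have -> : \row_i real_complex R (l i) = spectral_diag B.
    by apply/rowP => i; rewrite mxE lE.
  by rewrite -invmx_unitary.
rewrite -(eigenvalue_map (real_complex R)); apply/eigenvalueP.
have Q_unit := unitarymx_unit Q_unitary.
exists (row i (spectralmx B)).
  rewrite -/B {2}B_eq rowE -!mulmxA mulKVmx // !mulmxA scalemxAl -rowE row_diag_mx.
  by congr (_ *: _ *m _); exact/esym/lE.
apply/eqP => /(congr1 (mulmxr (invmx (spectralmx B)))) /=.
rewrite rowE mulmxK // mul0mx => /matrixP/(_ 0 i)/eqP.
by rewrite !mxE !eqxx oner_eq0.
Qed.

(** In the eigenbasis with coordinates [u], the difference of the two sides is the sum of
    [(mu - l i) * |u i| ^ 2]. These terms are nonnegative and their sum is at most 0, so each
    vanishes: [u] lives on the coordinates with [l i = mu]. *)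
Lemma rayleigh (R : realType) (n : nat) (A : 'M[R]_n) (mu : R) (v : 'rV[R]_n) :
  A^T = A -> (forall a, eigenvalue A a -> a <= mu) ->
  mu * (v *m v^T) 0 0 <= (v *m A *m v^T) 0 0 -> v *m A = mu *: v.
Proof.
move=> /real_spectral [Q [l [Q_unitary l_eig A_eq]]] l_le.
set f := real_complex R in A_eq *; pose w := map_mx f v; pose u := w *m Q^t*.
have wt : w^t* = w^T.
  by apply/matrixP => i j; rewrite !mxE; apply/CrealP; rewrite complex_real.
have Qw : Q *m w^T = u^t* by rewrite trmx_mul map_mxM trmxCK wt.
have wE : w = u *m Q by rewrite mulmxKtV.
have vvE : f ((v *m v^T) 0 0) = \sum_i `|u 0 i| ^+ 2.
  have -> : f ((v *m v^T) 0 0) = (w *m w^T) 0 0.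
    by rewrite /w map_trmx -map_mxM [RHS]mxE.
  rewrite {1}wE -mulmxA Qw mxE; apply: eq_bigr => i _.
  by rewrite !mxE normCK.
have vAvE : f ((v *m A *m v^T) 0 0) = \sum_i f (l i) * `|u 0 i| ^+ 2.
  have -> : f ((v *m A *m v^T) 0 0) = (w *m map_mx f A *m w^T) 0 0.
    by rewrite /w map_trmx -!map_mxM [RHS]mxE.
  rewrite A_eq !mulmxA -/u -mulmxA Qw mul_mx_diag mxE; apply: eq_bigr => i _.
  by rewrite !mxE normCK mulrA [_ * f (l i)]mulrC.
have f_le x y : (f x <= f y) = (x <= y) by rewrite lecR.
have fB x y : f (x - y) = f x - f y by exact: rmorphB.
have fM x y : f (x * y) = f x * f y by exact: rmorphM.
move=> ge_mu; have d_ge0 i : true -> 0 <= f (mu - l i) * `|u 0 i| ^+ 2.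
  move=> _; apply: mulr_ge0; last exact: exprn_ge0.
  by rewrite -[0]/(f 0) f_le subr_ge0 l_le.
have sum0 : \sum_i f (mu - l i) * `|u 0 i| ^+ 2 = 0.
  apply/eqP; rewrite eq_le sumr_ge0 // andbT.
  under eq_bigr do rewrite fB mulrBl.
  by rewrite sumrB -vAvE -mulr_sumr -vvE -fM subr_le0 f_le.
have /psumr_eq0P - /(_ sum0) u0 := d_ge0.
apply: (map_mx_inj (f := f)).
rewrite map_mxM map_mxZ -/w A_eq !mulmxA -/u wE scalemxAl; congr (_ *m _).
apply/rowP => i; rewrite mul_mx_diag [LHS]mxE [RHS]mxE [X in _ * X]mxE.
have /eqP := u0 i isT; rewrite mulf_eq0 expf_eq0 normr_eq0 /=.
case/orP => [/eqP|/eqP->]; last by rewrite mulr0 mul0r.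
by rewrite fB => /eqP; rewrite subr_eq0 => /eqP <-; rewrite mulrC.
Qed.

Lemma symmetric_eigenvalue (R : realType) (n : nat) (A : 'M[R]_n) :
  (0 < n)%N -> A^T = A -> exists a, eigenvalue A a.
Proof.
case: n A => // n A _ /real_spectral [_ [l [_ l_eig _]]].
by exists (l ord0).
Qed.

(* The weights w dominate a suitable multiple of any eigenvector, touching it
   at one vertex. *)
Lemma collatz_wielandt (R : realType) (n : nat) (A : 'M[R]_n) (mu : R)
    (w : 'I_n -> R) (a : R) :
  (forall i j, 0 <= A i j) -> (forall i, 0 < w i) ->
  (forall j, \sum_i w i * A i j <= mu * w j) -> eigenvalue A a -> a <= mu.
Proof.
move=> A_ge0 w_gt0 Aw /eigenvalueP [v vA v_neq0].
have [i0 vi0] : exists i, v 0 i != 0 by apply/rV0Pn.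
pose q i := `|v 0 i| / w i.
have [m _ q_max] := @Order.TotalTheory.arg_maxP _ _ _ i0 xpredT q isT.
have v_le i : `|v 0 i| <= q m * w i by rewrite -ler_pdivrMr //; exact: q_max.
have qm_gt0 : 0 < q m.
  by apply: lt_le_trans (q_max i0 isT); rewrite divr_gt0 ?normr_gt0.
have vm : `|v 0 m| = q m * w m by rewrite divfK // gt_eqF.
have vm_gt0 : 0 < `|v 0 m| by rewrite vm mulr_gt0.
rewrite -(ler_pM2r vm_gt0); apply: le_trans (ler_norm _) _.
rewrite normrM normr_id -normrM.
have /rowP/(_ m) := vA; rewrite !mxE => <-.
apply: le_trans (ler_norm_sum _ _ _) _.
apply: (@le_trans _ _ (\sum_i q m * w i * A i m)).
  apply: ler_sum => i _; rewrite normrM (ger0_norm (A_ge0 _ _)).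
  exact: ler_wpM2r.
under eq_bigr do rewrite -mulrA.
by rewrite -mulr_sumr vm mulrCA ler_pM2l.
Qed.
End Rayleigh.

(** * Graph distance and the distance spectral radius *)

Section Distance.
Variable G : sgraph.
Implicit Types x y : G.

Lemma bigminn_le (I : finType) (P : pred I) (F : I -> nat) (e : nat) (i : I) :
  P i -> \big[minn/e]_(j | P j) F j <= F i.
Proof.
move=> Pi; rewrite -big_filter.
have : i \in [seq j <- index_enum I | P j] by rewrite mem_filter Pi mem_index_enum.
elim: [seq _ <- _ | _] => // j s IH; rewrite inE big_cons => /predU1P[->|/IH].
  exact: geq_minl.
by apply: leq_trans; exact: geq_minr.
Qed.

Lemma min_degree_leP (k : nat) :
  k <= min_degree G -> forall x, k <= #|[set y | adj x y]|.
Proof.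
move=> k_le x; apply: leq_trans k_le _; rewrite /min_degree.
exact: bigminn_le.
Qed.

Lemma has_path0 x y : has_path x y 0 = (x == y).
Proof.
apply/fintype.existsP/eqP => [[p]|<-]; first by rewrite tuple0 => /and3P[_ _ /eqP].
by exists [tuple]; rewrite /= eqxx.
Qed.

Lemma has_path1 x y : has_path x y 1 = adj x y.
Proof.
apply/fintype.existsP/idP => [[p]|xy].
  by case: p => -[|z []] //= _; rewrite andbT => /and3P[+ _ /eqP <-].
exists [tuple y]; rewrite /= xy eqxx inE !andbT.
by apply: contraTneq xy => ->; rewrite adj_irr.
Qed.

Lemma has_path_sym x y d : has_path x y d = has_path y x d.
Proof.
suff sub (u v : G) : has_path u v d -> has_path v u d by apply/idP/idP; exact: sub.

case/fintype.existsP => p /and3P[p_path p_uniq /eqP p_last].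
have sz : size (rev (belast u p)) == d by rewrite size_rev size_belast size_tuple.
apply/fintype.existsP; exists (Tuple sz); rewrite /= -p_last rev_path.
have -> : last (last u p) (rev (belast u p)) = u.
  by case: (tval p) => //= a s; rewrite rev_cons last_rcons.
rewrite eqxx andbT; apply/andP; split.
  by rewrite (eq_path (e' := @adj G)) // => a b; exact: adj_sym.
by rewrite -[_ && _]/(uniq (_ :: _)) -rev_rcons -lastI rev_uniq.
Qed.

Lemma dist_sym x y : dist x y = dist y x.
Proof. by apply: eq_bigl => d; exact: has_path_sym. Qed.

Lemma dist_le x y d : d < #|G| -> has_path x y d -> dist x y <= d.
Proof. by move=> dG; exact: (bigminn_le _ _ (i := Ordinal dG)). Qed.

(** The bound [m <= #|G|] handles the default value of the minimum that defines [dist]. *)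
Lemma dist_ge x y m :
  m <= #|G| -> (forall d, d < #|G| -> has_path x y d -> m <= d) -> m <= dist x y.
Proof.
move=> mG m_le; rewrite /dist; elim/big_ind: _ => // [a b ma mb|d].
  by rewrite leq_min ma.
exact: m_le.
Qed.

Lemma dist_xx x : dist x x = 0.
Proof.
apply/eqP; rewrite -leqn0; apply: dist_le; last by rewrite has_path0.
by apply/card_gt0P; exists x.
Qed.

Lemma card_gt1_neq x y : x != y -> 1 < #|G|.
Proof. by move=> xy; apply/card_gt1P; exists x, y. Qed.

Lemma dist_adj x y : adj x y -> dist x y = 1.
Proof.
move=> xy; have x_neq_y : x != y by apply: contraTneq xy => ->; rewrite adj_irr.
have G_gt1 := card_gt1_neq x_neq_y.
apply/eqP; rewrite eqn_leq dist_le ?has_path1 //= dist_ge //; first exact: ltnW.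
by case=> // _; rewrite has_path0 (negPf x_neq_y).
Qed.

Lemma dist_nadj x y : 2 <= #|G| -> x != y -> ~~ adj x y -> 2 <= dist x y.
Proof.
move=> G_gt1 x_neq_y nxy; apply: dist_ge => // -[|[|d]] // _.
  by rewrite has_path0 (negPf x_neq_y).
by rewrite has_path1 (negPf nxy).
Qed.

Lemma dist_common x y z : x != y -> ~~ adj x y -> adj x z -> adj z y ->
  dist x y = 2.
Proof.
move=> x_neq_y nxy xz zy; apply/eqP; rewrite eqn_leq dist_nadj //;
  last exact: card_gt1_neq x_neq_y.
have xz' : x != z by apply: contraTneq xz => ->; rewrite adj_irr.
have zy' : z != y by apply: contraTneq zy => ->; rewrite adj_irr.
rewrite andbT; apply: dist_le.
  (* Three distinct vertices put the length 2 in the range [d < #|G|] of the minimum. *)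
  by apply/card_gt2P; exists x, z, y; split=> //; rewrite xz' zy' eq_sym.
by apply/fintype.existsP; exists [tuple z; y];
  rewrite /= xz zy !inE negb_or xz' x_neq_y zy' eqxx.
Qed.

Section Radius.
Local Open Scope ring_scope.
Variable R : realType.
Implicit Type w : G -> R.

Lemma sum_enum_val (F : G -> R) : \sum_(i < #|G|) F (enum_val i) = \sum_x F x.
Proof. by rewrite (reindex (@enum_val G G)) //; exact/onW_bij/enum_val_bij. Qed.

Lemma distmx_sym : (distmx R G)^T = distmx R G.
Proof. by apply/matrixP => i j; rewrite !mxE dist_sym. Qed.

Lemma distmx_eigenvalue_le w (mu a : R) :
  (forall x, 0 < w x) -> (forall x, \sum_y (dist x y)%:R * w y <= mu * w x) ->
  eigenvalue (distmx R G) a -> a <= mu.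
Proof.
move=> w_gt0 w_le; apply: (collatz_wielandt (w := w \o enum_val)) => //.
- by move=> i j; rewrite mxE ler0n.
- by move=> i; exact: w_gt0.
move=> j; apply: le_trans (w_le (enum_val j)); rewrite -sum_enum_val.
by apply: ler_sum => i _; rewrite mxE dist_sym mulrC.
Qed.

Lemma dist_radius_le w (mu : R) : (0 < #|G|)%N ->
  (forall x, 0 < w x) -> (forall x, \sum_y (dist x y)%:R * w y <= mu * w x) ->
  dist_radius R G <= mu.
Proof.
move=> G_gt0 w_gt0 w_le; apply: ge_sup => [|a /=];
  last exact: distmx_eigenvalue_le w_le.
exact: symmetric_eigenvalue distmx_sym.
Qed.

Lemma dist_radius_ub (a : R) :
  eigenvalue (distmx R G) a -> a <= dist_radius R G.
Proof.
move=> a_eig; apply: ub_le_sup => //.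
(* A supremum bounds its set only if the set is bounded above; the total of all distances exceeds
   every row sum, hence every eigenvalue by the constant weight 1. *)
exists (\sum_(x : G) \sum_(y : G) (dist x y)%:R) => b /=.
apply: (distmx_eigenvalue_le (w := fun=> 1)) => // x.
rewrite -mulr_suml !mulr1.
by rewrite [leRHS](bigD1 x) //= lerDl !sumr_ge0 // => *; rewrite ?sumr_ge0.
Qed.

Lemma dist_rayleigh w (mu : R) : dist_radius R G <= mu ->
  mu * (\sum_x w x ^+ 2) <= \sum_x w x * (\sum_y (dist x y)%:R * w y) ->
  forall x, \sum_y (dist x y)%:R * w y = mu * w x.
Proof.
move=> rad_le w_ge x.
pose v : 'rV[R]_#|G| := \row_i w (enum_val i).
have vD j : (v *m distmx R G) 0 j = \sum_y (dist (enum_val j) y)%:R * w y.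
  rewrite mxE -sum_enum_val; apply: eq_bigr => i _.
  by rewrite !mxE dist_sym mulrC.
have vv : (v *m v^T) 0 0 = \sum_x w x ^+ 2.
  by rewrite mxE -sum_enum_val; apply: eq_bigr => i _; rewrite !mxE.
have vDv : (v *m distmx R G *m v^T) 0 0 = \sum_x w x * (\sum_y (dist x y)%:R * w y).
  by rewrite mxE -sum_enum_val; apply: eq_bigr => i _; rewrite vD !mxE mulrC.
have /rowP/(_ (enum_rank x)) : v *m distmx R G = mu *: v.
  apply: rayleigh; first exact: distmx_sym; last by rewrite vv vDv.
  by move=> a /dist_radius_ub/le_trans; apply.
by rewrite vD !mxE enum_rankK.
Qed.
End Radius.
End Distance.

(** * Components and forests of edge sets *)

Section Forests.
Variable V : finType.
Implicit Types (x y z : V) (e f : {set V}) (F H : {set {set V}}).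

Definition econn F : rel V := connect (edge_rel F).

Definition component F x : {set V} := [set y | econn F x y].

Definition comps F : {set {set V}} := [set component F x | x : V].

Definition ncomp F : nat := #|comps F|.

Lemma econn_sym F : symmetric (econn F).
Proof. by apply: sym_connect_sym => x y; rewrite /edge_rel /= finset.setUC. Qed.

Lemma econn_refl F x : econn F x x. Proof. exact: connect0. Qed.

Lemma econn_trans F : transitive (econn F). Proof. exact: connect_trans. Qed.

Lemma econn1 F x y : [set x; y] \in F -> econn F x y.
Proof. by move=> xy; apply: connect1. Qed.

Lemma sub_econn F H :
  (forall x y, [set x; y] \in F -> econn H x y) ->
  forall x y, econn F x y -> econn H x y.
Proof. by move=> FH; apply: connect_sub => x y; exact: FH. Qed.

Lemma econnS F H x y : F \subset H -> econn F x y -> econn H x y.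
Proof.
by move=> FH; apply: sub_econn => a b /(fintype.subsetP FH); exact: econn1.
Qed.

Lemma compP F x y : reflect (component F x = component F y) (econn F x y).
Proof.
apply: (iffP idP) => [xy|/setP/(_ y)]; last by rewrite !inE econn_refl.
apply/setP => z; rewrite !inE; apply/idP/idP; apply: econn_trans => //.
by rewrite econn_sym.
Qed.

Lemma eq_set2 a b x y : [set a; b] = [set x; y] ->
  (a = x /\ b = y) \/ (a = y /\ b = x).
Proof.
move=> eq_ab.
have: a \in [set x; y] by rewrite -eq_ab set21.
have: b \in [set x; y] by rewrite -eq_ab set22.
have: x \in [set a; b] by rewrite eq_ab set21.
have: y \in [set a; b] by rewrite eq_ab set22.
rewrite !inE.
by do 4![case/orP => /eqP ?]; subst; auto.
Qed.

Lemma econn_add F x y a b : econn ([set x; y] |: F) a b =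
  [|| econn F a b, econn F a x && econn F y b | econn F a y && econn F x b].
Proof.
have sub : F \subset [set x; y] |: F by apply: finset.subsetUr.
have xy : econn ([set x; y] |: F) x y by rewrite econn1 ?setU11.
apply/idP/or3P; last first.
  case=> [/(econnS sub)//|/andP[/(econnS sub) ax /(econnS sub) yb]
         |/andP[/(econnS sub) ay /(econnS sub) xb]].
    exact: econn_trans ax (econn_trans xy yb).
  by apply: econn_trans ay (econn_trans _ xb); rewrite econn_sym.
case/connectP => p; elim: p a => [a _ ->|z p IH a /= /andP[az zp] b_last].
  by constructor 1; exact: econn_refl.
have {IH zp b_last} := IH z zp b_last.
move: az; rewrite /edge_rel /= !inE => /orP[/eqP/eq_set2[] [-> ->]|/econn1 az] zb.
- case: zb => [zb|/andP[_ yb]|/andP[_ xb]].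
  + by constructor 2; rewrite econn_refl.
  + by constructor 2; rewrite econn_refl.
  + by constructor 1.
- case: zb => [zb|/andP[_ yb]|/andP[_ xb]].
  + by constructor 3; rewrite econn_refl.
  + by constructor 1.
  + by constructor 3; rewrite econn_refl.
- case: zb => [zb|/andP[zx yb]|/andP[zy xb]].
  + by constructor 1; exact: econn_trans az zb.
  + by constructor 2; rewrite (econn_trans az zx).
  + by constructor 3; rewrite (econn_trans az zy).
Qed.

Lemma comps_econn F H : econn F =2 econn H -> comps F = comps H.
Proof.
move=> FH; apply: eq_imset => x; apply/setP => y; rewrite !inE; exact: FH.
Qed.

Lemma ncomp_add_conn F x y : econn F x y -> ncomp ([set x; y] |: F) = ncomp F.
Proof.
move=> xy; rewrite /ncomp (@comps_econn _ F) // => a b; rewrite econn_add.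
apply/or3P/idP => [[//||]|ab]; last by constructor 1.
  by case/andP => ax yb; exact: econn_trans ax (econn_trans xy yb).
case/andP => ay xb; apply: econn_trans ay (econn_trans _ xb).
by rewrite econn_sym.
Qed.

(** The new edge replaces the components of its two ends by their union [U] and leaves the other
    components unchanged. *)
Lemma ncomp_add F x y : ~~ econn F x y -> ncomp F = (ncomp ([set x; y] |: F)).+1.
Proof.
move=> nxy; set F' := _ |: F; pose U := component F x :|: component F y.
have compU z : z \in U -> component F' z = U.
  move=> zU; apply/setP => b; rewrite !inE econn_add.
  move: zU; rewrite !inE => /orP[xz|yz].
    have zE b' : econn F z b' = econn F x b'.
      by apply/idP/idP; apply: econn_trans; rewrite // econn_sym.
    by rewrite !zE econn_refl /= (negPf nxy) orbF.
  have zE b' : econn F z b' = econn F y b'.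
    by apply/idP/idP; apply: econn_trans; rewrite // econn_sym.
  by rewrite !zE econn_refl /= [econn F y x]econn_sym (negPf nxy) /= orbC.
have compNU z : z \notin U -> component F' z = component F z.
  rewrite !inE negb_or => /andP[xz yz]; apply/setP => b; rewrite !inE econn_add.
  by rewrite ![econn F z _]econn_sym (negPf xz) (negPf yz) !orbF econn_sym.
have compsE : comps F' = U |: (comps F :\ component F x :\ component F y).
  apply/setP => C; apply/imsetP/idP => [[z _ ->]|].
    have [/compU ->|zU] := boolP (z \in U); first by rewrite setU11.
    rewrite compNU // !inE imset_f // andbT.
    move: zU; rewrite !inE negb_or => /andP[xz yz].
    by apply/orP; right; apply/andP; split; apply/negP => /eqP/compP;
       rewrite econn_sym ?(negPf xz) ?(negPf yz).
  rewrite !inE => /orP[/eqP->|/and3P[Cy Cx /imsetP[z _ Cz]]].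
    by exists x; rewrite // compU // !inE econn_refl.
  exists z => //; rewrite compNU // !inE negb_or.
  by apply/andP; split; apply/negP => /compP zE; rewrite Cz zE eqxx in Cx Cy.
rewrite /ncomp compsE cardsU1 (_ : U \notin _ = true); last first.
  rewrite !inE; apply/negP => /and3P[_ Ux /imsetP[z _ UE]].
  move: Ux; rewrite UE; have : x \in U by rewrite !inE econn_refl.
  by rewrite UE inE => /compP ->; rewrite eqxx.
rewrite (cardsD1 (component F x) (comps F)) (imset_f (component F)) //=.
rewrite (cardsD1 (component F y) (_ :\ _)) !inE (imset_f (component F)) //= andbT.
by rewrite (_ : _ != _) ?add1n //; apply: contra nxy => /eqP/esym/compP.
Qed.

Lemma econn0 x y : econn finset.set0 x y = (x == y).
Proof.
apply/idP/eqP => [/connectP[[|z p] //= ]|->]; last exact: econn_refl.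
by rewrite /edge_rel /= finset.in_set0.
Qed.

Lemma ncomp0 : ncomp finset.set0 = #|V|.
Proof.
rewrite /ncomp card_imset // => x y /compP; by rewrite econn0 => /eqP.
Qed.

Lemma comps_partition F : finset.partition (comps F) [set: V].
Proof.
have -> : comps F = equivalence_partition (econn F) [set: V].
  by apply/setP => C; apply/imsetP/imsetP => -[x _ ->]; exists x; rewrite ?inE //;
     apply/setP => y; rewrite !inE.
apply: equivalence_partitionP => x y z _ _ _; split; first exact: econn_refl.
by move=> xy; apply/idP/idP; apply: econn_trans; rewrite // econn_sym.
Qed.

(** The ends may coincide; a loop is harmless, since no [forest] contains one. *)
Definition simple_edges (E : {set {set V}}) := forall e, e \in E -> exists x y : V, e =
  [set x; y].

Lemma ncomp_leS F e : (exists x y, e = [set x; y]) ->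
  ncomp (e |: F) <= ncomp F <= (ncomp (e |: F)).+1.
Proof.
case=> x [y ->]; have [xy|xy] := boolP (econn F x y).
  by rewrite ncomp_add_conn // leqnn leqnSn.
by rewrite (ncomp_add xy) leqnSn leqnn.
Qed.

(** Each added edge raises the cardinal by one and lowers [ncomp] by at most one. *)
Lemma card_ncompS F H : simple_edges H -> F \subset H ->
  #|F| + ncomp F <= #|H| + ncomp H.
Proof.
move=> H2; move: {2}#|H :\: F| (erefl #|H :\: F|) => m.
elim: m F => [|m IH] F HF FH.
  have -> // : F = H; apply/eqP; rewrite finset.eqEsubset FH -finset.setD_eq0.
  by rewrite -cards_eq0 HF.
have [e] : exists e, e \in H :\: F by apply/card_gt0P; rewrite HF.
rewrite !inE => /andP[eF eH].
have /andP[_ le1] := ncomp_leS F (H2 e eH).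
apply: (@leq_trans (#|e |: F| + ncomp (e |: F))).
  by rewrite cardsU1 eF add1n addSnnS leq_add2l.
apply: IH; last by rewrite finset.subUset finset.sub1set eH.
have -> : H :\: (e |: F) = (H :\: F) :\ e.
  by apply/setP => z; rewrite !inE negb_or andbA.
by move: HF; rewrite (cardsD1 e) !inE eF eH => -[].
Qed.

(** Acyclicity in terms of rank: among sets of simple edges [#|V|] is the least value of the left
    side, attained when every edge in turn merges two components. *)
Definition forest F := #|F| + ncomp F == #|V|.

(** The sum is monotone, hence squeezed between its values at the empty set and at [H], both equal
    to [#|V|]. *)
Lemma forestS F H : simple_edges H -> F \subset H -> forest H -> forest F.
Proof.
move=> H2 FH /eqP HE; rewrite /forest eqn_leq -{1}HE card_ncompS //=.
rewrite -ncomp0 -[ncomp finset.set0]add0n -(@cards0 {set V}) card_ncompS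
  ?finset.sub0set //.
by move=> e /(fintype.subsetP FH); exact: H2.
Qed.

Lemma forest_add F x y : forest F -> ~~ econn F x y -> forest ([set x; y] |: F).
Proof.
move=> /eqP FE nxy; rewrite /forest cardsU1 -FE (ncomp_add nxy).
have -> : [set x; y] \notin F by apply: contra nxy => /econn1.
by rewrite /= add1n addSnnS.
Qed.

(** Otherwise deleting the edge would keep [ncomp] and lower the cardinal, although the smaller set
    is a forest too. *)
Lemma forest_bridge F x y : simple_edges F -> forest F -> [set x; y] \in F ->
  ~~ econn (F :\ [set x; y]) x y.
Proof.
move=> F2 /eqP FE xyF; apply/negP => /ncomp_add_conn.
rewrite finset.setD1K // => ncE.
have : forest (F :\ [set x; y]) by apply: forestS (F2) (finset.subD1set _ _) _;
  exact/eqP.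
by rewrite /forest -ncE -FE (cardsD1 [set x; y] F) xyF add1n addSn ltn_eqF.
Qed.

(* A minimal subset of F joining x to y is the path of F between them. *)
Lemma forest_path F x y : simple_edges F -> forest F -> econn F x y ->
  exists2 H : {set {set V}}, H \subset F &
    econn H x y /\ forall f, f \in H -> ~~ econn (F :\ f) x y.
Proof.
move=> F2 FF xy.
have [H /minsetP[/= /andP[HF Hxy] Hmin] _] :=
  @minset_exists _ (fun H : {set {set V}} => (H \subset F) && econn H x y) F
    (introT andP (conj (subxx _) xy)).
exists H => //; split=> // f fH; have [a [b fE]] := F2 f (fintype.subsetP HF f fH).
have H'xy : ~~ econn (H :\ f) x y.
  apply/negP => H'xy; have := Hmin (H :\ f); rewrite H'xy finset.subD1set.
  rewrite (fintype.subset_trans (finset.subD1set _ _) HF) => /(_ isT isT) HE.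
  by have := setD11 f H; rewrite HE fH.
have sub : H :\ f \subset F :\ f by exact: finset.setSD.
have : econn (f |: (H :\ f)) x y by rewrite finset.setD1K.
(* By minimality [H] without [f] joins [x] to one end of [f] and [y] to the other. If [F] without
   [f] joined [x] to [y], it would join the ends of [f], which is a bridge. *)
have := forest_bridge F2 FF (x := a) (y := b);
  rewrite -fE => /(_ (fintype.subsetP HF f fH)).
rewrite {2}fE econn_add (negPf H'xy) /= => nab xy'; apply: contra nab => Fxy.
case/orP: xy' => /andP[/(econnS sub) p /(econnS sub) q].
  by rewrite (econn_trans _ (econn_trans Fxy _)) // econn_sym.
rewrite econn_sym in Fxy.
by rewrite (econn_trans q) // (econn_trans Fxy).
Qed.
End Forests.

(** * Packing spanning trees by exchanges of edges *)

Section TreePacking.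
Variables (V : finType) (E : {set {set V}}) (k : nat).
Hypothesis E2 : simple_edges E.

Local Notation coloring := {ffun {set V} -> option 'I_k}.
Implicit Types (c d : coloring) (e f : {set V}).

Definition color_class c i : {set {set V}} := [set e | c e == Some i].

Definition covered c : {set {set V}} := [set e | c e != None].

(** A partial packing of [k] forests: an edge has at most one color, so the classes are disjoint by
    construction. *)
Definition forest_coloring c := (covered c \subset E) && [forall i, forest (color_class
  c i)].

(** The basic move of the matroid union argument: the role of uncovered edge passes from [e] to
    [f]. *)
Definition exchange c e f (i : 'I_k) : coloring :=
  [ffun h => if h == e then Some i else if h == f then None else c h].

Definition exchange_step : rel coloring := fun c d =>
  forest_coloring d && [exists e in E, exists f, exists i,
    [&& c e == None, c f == Some i & d == exchange c e f i]].

Lemma color_class_covered c i : color_class c i \subset covered c.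
Proof. by apply/fintype.subsetP => e; rewrite !inE => /eqP->. Qed.

Lemma forest_coloring_class c i : forest_coloring c ->
  [/\ color_class c i \subset E, simple_edges (color_class c i) & forest (color_class c
    i)].
Proof.
case/andP => cE /forallP; split=> //.
  exact: fintype.subset_trans (color_class_covered c i) cE.
move=> e /(fintype.subsetP (color_class_covered c i))/(fintype.subsetP cE).
exact: E2.
Qed.

Lemma card_covered c (X : {set {set V}}) :
  #|covered c :&: X| = \sum_i #|color_class c i :&: X|.
Proof.
rewrite -sum1_card big_mkcond /=.
under [RHS]eq_bigr do rewrite -sum1_card big_mkcond /=.
rewrite exchange_big; apply: eq_bigr => e _; rewrite !inE.
case ce: (c e) => [i|]; last by rewrite big1 // => i _; rewrite !inE ce.
rewrite (bigD1 i) //= big1 ?addn0 ?inE ?ce ?eqxx // => j /negPf ji.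
by rewrite !inE ce (inj_eq Some_inj) eq_sym ji.
Qed.

Definition maximal_coloring c := forest_coloring c /\ forall d, forest_coloring d ->
  #|covered d| <= #|covered c|.

Lemma maximal_coloring_exists : exists c, maximal_coloring c.
Proof.
have g0 : forest_coloring [ffun=> None].
  rewrite /forest_coloring; apply/andP; split.
    by apply/fintype.subsetP => e; rewrite !inE ffunE.
  apply/forallP => i; rewrite (_ : color_class _ _ = finset.set0) /forest ?ncomp0
    ?cards0 //.
  by apply/setP => e; rewrite !inE ffunE.
by case: (arg_maxnP (fun c : coloring => #|covered c|) g0) => c; exists c.
Qed.

Lemma covered_exchange c e f i : c e = None -> c f = Some i ->
  #|covered (exchange c e f i)| = #|covered c|.
Proof.
move=> ce cf; have fe : f != e by apply: contra_eq_neq cf => ->; rewrite ce.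
have -> : covered (exchange c e f i) = e |: (covered c :\ f).
  by apply/setP => h; rewrite !inE ffunE; case: (h == e); case: (h == f).
by rewrite cardsU1 (cardsD1 f (covered c)) !inE ce cf eqxx andbF.
Qed.

Lemma color_class_exchange c e f i j : c e = None -> c f = Some i ->
  color_class (exchange c e f i) j = if j == i then e |: (color_class c i :\ f) else
    color_class c j.
Proof.
move=> ce cf; apply/setP => h; rewrite !inE ffunE.
have fe : f != e by apply: contra_eq_neq cf => ->; rewrite ce.
case: (eqVneq j i) => [->|ji]; rewrite !inE.
  by case: (eqVneq h e) => [->|_]; rewrite ?eqxx //; case: (h == f).
case: (eqVneq h e) => [->|_];
  first by rewrite ce /= (inj_eq Some_inj) [i == j]eq_sym (negPf ji).
by case: (eqVneq h f) => [->|_] //;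
  rewrite cf (inj_eq Some_inj) [i == j]eq_sym (negPf ji).
Qed.

Section Maximal.
Variable c0 : coloring.
Hypothesis c0_max : maximal_coloring c0.

Lemma exchange_steps_maximal c : connect exchange_step c0 c -> maximal_coloring c.
Proof.
case/connectP => p; elim/last_ind: p c => [c _ ->//|p d IH c].
rewrite rcons_path last_rcons => /andP[/IH/(_ erefl) [_ max] /andP[gd ex]] ->.
split=> // d' /max; suff -> : #|covered d| = #|covered (last c0 p)| by [].
move: ex => /exists_inP[e _ /fintype.existsP[f /fintype.existsP[i /and3P[/eqP ce /eqP
  cf /eqP->]]]].
exact: covered_exchange.
Qed.

(* The edges that some sequence of exchanges leaves uncovered. *)
Definition exchangeable : {set {set V}} :=
  [set e in E | [exists c, connect exchange_step c0 c && (c e == None)]].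

Local Notation A := exchangeable.

(** Color [i] joins the ends of the uncovered edge, since otherwise giving it color [i] would cover
    one more edge. Each edge [f] of the joining path can be exchanged for it, and is then uncovered,
    so the path lies in [A]. *)
Lemma uncovered_conn c x y i : connect exchange_step c0 c -> [set x; y] \in E ->
  c [set x; y] = None -> econn (color_class c i :&: A) x y.
Proof.
move=> c0c eE ce; set e := [set x; y] in eE ce.
have [gc maxc] := exchange_steps_maximal c0c;
  have [cE c2 cF] := forest_coloring_class i gc.
have [xy|nxy] := boolP (econn (color_class c i) x y); last first.
  pose d : coloring := [ffun h => if h == e then Some i else c h].
  have covd : covered d = e |: covered c.
    by apply/setP => h; rewrite !inE ffunE; case: (h == e).
  suff /maxc : forest_coloring d by rewrite covd cardsU1 !inE ce eqxx ltnn.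
  rewrite /forest_coloring covd finset.subUset finset.sub1set eE;
    case/andP: (gc) => -> /forallP cf.
  apply/forallP => j; case: (eqVneq j i) => [->|ji].
    have -> : color_class d i = e |: color_class c i.
      by apply/setP => h; rewrite !inE ffunE; case: (h == e); rewrite ?eqxx.
    exact: forest_add.
  have -> // : color_class d j = color_class c j.
  apply/setP => h; rewrite !inE ffunE; case: (eqVneq h e) => // ->.
  by rewrite ce (inj_eq Some_inj) eq_sym (negPf ji).
have [H HF [Hxy Hbr]] := forest_path c2 cF xy.
apply: econnS Hxy; rewrite finset.subsetI HF; apply/fintype.subsetP => f fH.
have fc := fintype.subsetP HF f fH; have cf : c f = Some i by move: fc;
  rewrite inE => /eqP.
rewrite inE (fintype.subsetP cE f fc); apply/fintype.existsP; exists (exchange c e f i).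
rewrite ffunE eqxx; have /negPf -> : f != e by apply: contra_eq_neq cf => ->;
  rewrite ce.
rewrite andbT; apply: connect_trans c0c (connect1 _); apply/andP; split; last first.
  apply/exists_inP; exists e => //; apply/fintype.existsP; exists f.
  by apply/fintype.existsP; exists i; rewrite ce cf !eqxx.
apply/andP; split.
  apply/fintype.subsetP => h; rewrite !inE ffunE.
  case: (eqVneq h e) => [->//|_]; case: (eqVneq h f) => // _ hc.
  by case/andP: gc => /fintype.subsetP cE' _; apply: cE'; rewrite inE.
apply/forallP => j; rewrite color_class_exchange //; case: (eqVneq j i) => [_|_];
  last by case: (forest_coloring_class j gc).
by apply: forest_add (Hbr f fH); exact: forestS c2 (finset.subD1set _ _) cF.
Qed.

(** An edge of a class of [d] either belongs to the same class of [c] or is the edge [g] that the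
    step brought in; the ends of [g] are joined by [uncovered_conn]. Connection inside [A] thus
    passes backwards along a step. *)
Lemma exchange_step_conn c d x y : connect exchange_step c0 c -> exchange_step c d ->
  (forall i, econn (color_class d i :&: A) x y) -> forall i, econn (color_class c i :&:
    A) x y.
Proof.
move=> c0c /andP[gd /exists_inP[g gE /fintype.existsP[f /fintype.existsP[j]]]].
case/and3P => /eqP cg /eqP cf /eqP dE dxy i; have := dxy i; apply: sub_econn => a b.
rewrite !inE dE ffunE => /andP[+ abA].
case: ([set a; b] =P g) => [abg _|_]; first by apply: uncovered_conn; rewrite ?abg.
by case: (_ == f) => // cab; apply: econn1; rewrite !inE cab abA.
Qed.

(** Start from a coloring that leaves the edge uncovered and go back to [c0] one exchange at a
    time. *)
Lemma exchangeable_conn x y i : [set x; y] \in A -> econn (color_class c0 i :&: A) x y.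
Proof.
rewrite inE => /andP[eE /fintype.existsP[c /andP[c0c /eqP ce]]].
have {ce eE} : forall i, econn (color_class c i :&: A) x y.
  by move=> j; exact: uncovered_conn.
case/connectP: c0c => p; move: i; elim/last_ind: p c => [c /= i _ ->|p d IH c i].
  exact.
rewrite rcons_path last_rcons => /andP[pP pd] -> dxy.
by apply: (IH _ i pP erefl); apply: exchange_step_conn pd dxy; apply/connectP; exists p.
Qed.

Lemma econn_exchangeable i : econn (color_class c0 i :&: A) =2 econn A.
Proof.
move=> x y; apply/idP/idP; first exact/econnS/finset.subsetIr.
apply: sub_econn => a b; exact: exchangeable_conn.
Qed.

Lemma covered_exchangeable : E :\: A \subset covered c0.
Proof.
apply/fintype.subsetP => e; rewrite !inE => /andP[+ eE];
  rewrite eE /= => /fintype.existsPn.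
by move=> /(_ c0); rewrite connect0.
Qed.
End Maximal.

Lemma ncomp_gt0 (F : {set {set V}}) : 0 < #|V| -> 0 < ncomp F.
Proof. by case/card_gt0P => x _; apply/card_gt0P; exists (component F x);
  exact: imset_f. Qed.

Lemma ncomp_le (F : {set {set V}}) : ncomp F <= #|V|.
Proof. exact: leq_imset_card. Qed.

(* The nontrivial direction of the Nash-Williams--Tutte theorem, in which the
   bad partition of V is that into the components of A. *)
Theorem tree_packing : 0 < #|V| ->
  (exists F : 'I_k -> {set {set V}},
     (forall i, [/\ F i \subset E, forest (F i) & ncomp (F i) = 1]) /\
     (forall i j e, e \in F i -> e \in F j -> i = j))
  \/ exists2 A : {set {set V}}, A \subset E & #|E :\: A| + k < k * ncomp A.
Proof.
move=> V_gt0; have [c c_max] := maximal_coloring_exists; have [gc _] := c_max.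
have [all1|] := boolP [forall i, ncomp (color_class c i) == 1].
  left; exists (color_class c); split=> [i|i j e].
    by have [? _ ?] := forest_coloring_class i gc; split=> //;
      exact/eqP/(fintype.forallP all1).
  by rewrite !inE => /eqP-> /eqP[].
rewrite fintype.negb_forall => /fintype.existsP[i0 i0n1]; right.
pose A := exchangeable c; exists A.
  by apply/fintype.subsetP => e; rewrite inE => /andP[].
have clsE i : #|color_class c i| + ncomp (color_class c i) = #|V|.
  by apply/eqP; have [] := forest_coloring_class i gc.
(* Inside [A] every color class is a forest with the components of [A], which fixes its number of
   edges. *)
have clsAE i : #|color_class c i :&: A| + ncomp A = #|V|.
  have [_ c2 cF] := forest_coloring_class i gc.
  rewrite /ncomp -(comps_econn (econn_exchangeable c_max i)).
  exact/eqP/(forestS c2 (finset.subsetIl _ _) cF).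
have [/andP[cE _] _] := c_max.
have covE : E :\: A = covered c :&: ~: A.
  apply/setP => e; apply/idP/idP => [eEA|].
    by rewrite finset.in_setI (fintype.subsetP (@covered_exchangeable c) e eEA);
      move: eEA; rewrite !inE => /andP[].
  by rewrite finset.in_setI finset.in_setC finset.in_setD => /andP[/(fintype.subsetP
    cE) -> ->].
have : #|E :\: A| = \sum_i (#|color_class c i| - #|color_class c i :&: A|).
  rewrite covE card_covered; apply: eq_bigr => i _.
  by rewrite -finset.setDE cardsD.
move=> ->.
(* Class [i] has [ncomp A - ncomp (color_class c i)] edges outside [A], hence at most [ncomp A - 1].
   The disconnected class [i0] has fewer, which makes the total strict. *)
have lt i : #|color_class c i| - #|color_class c i :&: A| + 1 <= ncomp A.
  by have := ncomp_gt0 A V_gt0; have := clsE i; have := clsAE i;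
    have := ncomp_gt0 (color_class c i) V_gt0; lia.
have lt0 : #|color_class c i0| - #|color_class c i0 :&: A| + 1 < ncomp A.
  have := subset_leq_card (finset.subsetIl (color_class c i0) A); have := clsE i0;
    have := clsAE i0; have := ncomp_gt0 (color_class c i0) V_gt0; lia.
have -> : \sum_i (#|color_class c i| - #|color_class c i :&: A|) + k =
          \sum_i (#|color_class c i| - #|color_class c i :&: A| + 1).
  by rewrite big_split /= sum1_card card_ord.
have -> : k * ncomp A = \sum_(i < k) ncomp A by rewrite sum_nat_const card_ord.
rewrite (bigD1 i0) //= [X in _ < X](bigD1 i0) //=.
by rewrite -addSn leq_add // leq_sum.
Qed.
End TreePacking.

(** * From disjoint forests to [tau] *)

Section SpanningTrees.
Variable G : sgraph.
Implicit Types (x y z : G) (e : {set G}) (F : {set {set G}}).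

Lemma adj_neq x y : adj x y -> x != y.
Proof. by apply: contraTneq => ->; rewrite adj_irr. Qed.

Lemma edges_simple : simple_edges (edges G).
Proof. by move=> e /imsetP[[x y] _ ->]; exists x, y. Qed.

Lemma in_edges x y : ([set x; y] \in edges G) = adj x y.
Proof.
apply/imsetP/idP => [[[a b]]|xy]; last by exists (x, y); rewrite ?inE.
by rewrite inE /= => ab /eq_set2[[-> ->]|[-> ->]] //; rewrite adj_sym.
Qed.

(** A cycle minus its first edge still joins the ends of that edge, contrary to [forest_bridge]. *)
Lemma forest_acyclic F : simple_edges F -> forest F -> acyclic (edge_rel F).
Proof.
move=> F2 FF; apply/fintype.forallP => m; apply/fintype.forallP => c.
apply/negP => /and3P[m_ge3 c_uniq c_cycle].
have c_size := size_tuple c.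
case: (tval c) c_size c_uniq c_cycle => [|x [|y [|z s]]] sz;
  do ?by rewrite -sz in m_ge3.
set t := z :: s => /and3P[]; rewrite inE negb_or => /andP[xy xt] yt _.
rewrite (_ : cycle _ _ = edge_rel F x y && path (edge_rel F) y (rcons t x)) //.
rewrite rcons_path => /and3P[xyF ytF tx].
have /negP := forest_bridge F2 FF xyF; apply.
(* The walk from [y] to the last vertex avoids [x], so it does not use the edge from [x] to [y]. *)
have y_last : econn (F :\ [set x; y]) y (last y t).
  apply/connectP; exists t => //.
  have /sub_in_path : {in predC1 x &, subrel (edge_rel F) (edge_rel (F :\ [set x; y]))}.
    move=> a b; rewrite !inE /edge_rel /= => ax bx ab; rewrite !inE ab andbT.
    by apply: contra ax => /eqP/eq_set2[[-> _]|[_ bx']] //; rewrite bx' eqxx in bx.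
  apply => //; apply/allP => a; rewrite !inE => /predU1P[->|at_].
    by rewrite eq_sym.
  by apply: contraNneq xt => <-.
rewrite econn_sym; apply: econn_trans y_last (econn1 _).
rewrite !inE; apply/andP; split=> //; apply/eqP => /eq_set2[[_ yx]|[ly _]].
  by rewrite yx eqxx in xy.
by have := mem_last z s; rewrite -[last z s]/(last y t) ly (negPf yt).
Qed.

Lemma ncomp1_econn F x y : ncomp F = 1 -> econn F x y.
Proof.
move=> /eqP/cards1P[C FC]; have mem z : component F z = C.
  by apply/set1P; rewrite -FC; exact: imset_f.
by apply/compP; rewrite !mem.
Qed.

Lemma tau_ge k (F : 'I_k -> {set {set G}}) : 1 < #|G| ->
  (forall i, [/\ F i \subset edges G, forest (F i) & ncomp (F i) = 1]) ->
  (forall i j e, e \in F i -> e \in F j -> i = j) -> k <= tau G.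
Proof.
move=> G_gt1 F_tree F_disj.
(* A tree has [#|G| - 1 > 0] edges; disjoint nonempty sets are distinct, so the set of these trees
   has [k] elements. *)
have F_neq0 i : exists e, e \in F i.
  apply/card_gt0P; have [_ /eqP + F1] := F_tree i; rewrite F1 => FE.
  by rewrite -(ltn_add2r 1) FE.
have F_inj : injective F.
  by move=> i j Fij; have [e ei] := F_neq0 i; apply: (F_disj _ _ e); rewrite -?Fij.
rewrite -[k]card_ord -(card_imset _ F_inj); apply: leq_bigmax_cond.
apply/andP; split.
  apply/fintype.forallP => T; apply/implyP => /imsetP[i _ ->].
  have [FE FF F1] := F_tree i; apply/and3P; split=> //.
    by apply/fintype.forallP => x; apply/fintype.forallP => y; exact: ncomp1_econn.
  by apply: forest_acyclic => // e /(fintype.subsetP FE); exact: edges_simple.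
apply/finset.trivIsetP => _ _ /imsetP[i _ ->] /imsetP[j _ ->] Fij.
apply/pred0P => e /=; apply/negP => /andP[ei ej]; case/eqP: Fij.
by rewrite (F_disj _ _ _ ei ej).
Qed.
End SpanningTrees.

(* In the next three lemmas b is the number of edges crossing a partition into
   p parts, m2 the number of ordered nonadjacent pairs, and S (or c ^ 2 + ...)
   the sum of the squares of the sizes of the parts. *)
Lemma count_many_parts (n k p b m2 S : nat) : 2 <= k -> 2 * k + 2 <= n -> 4 <= p <= n
  -> n ^ 2 <= m2 + 2 * b + S ->
  b + k < k * p -> S + p * (n.+1 - p) <= (n.+1 - p).+1 * n ->
  6 * n <= m2 + 6 * k + 10 \/ n * (n - 1) + 2 <= m2 + 2 * k * (n - 1).
Proof.
move=> k2 n2 /andP[p4 pn] h1 h2 h3.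
have [q pq] : exists q, p = q.+1 by exists p.-1; lia.
have [M nM] : exists M, n = M + q by exists (n - q); lia.
rewrite pq nM (_ : (M + q).+1 - q.+1 = M) in h3; last lia.
rewrite {}pq in h2 p4 pn; rewrite {}nM in n2 h1 pn h3 *.
(* [M] is [n + 1 - p], the largest size that a part can have; [M = 1] is the partition into
   singletons. *)
have [M1|M1] := eqVneq M 1.
  right; subst M. rewrite (_ : 1 + q - 1 = q); last lia. nia.
left.
have [a qa] : exists a, q = a + 3 by exists (q - 3); lia.
have [c nc] : exists c, M + q = c + 2 * k + 2 by exists (M + q - 2 * k - 2); lia.
have [d Md] : exists d, M = d + 2 by exists (M - 2); lia.
subst q M.
(* Here [a], [c], [d] are the slacks in [p >= 4], [n >= 2 * k + 2] and [M >= 2]; this product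
   supplies the nonlinear term. *)
have := leq0n (a * (c + d)).
nia.
Qed.
Lemma count_two_parts (n k b m2 c d : nat) : 2 <= k -> 2 * k + 2 <= n -> c + d = n -> k
  < c -> k < d ->
  n ^ 2 <= m2 + 2 * b + (c ^ 2 + d ^ 2) -> b < k -> 
  6 * n <= m2 + 6 * k + 10.
Proof.
move=> k2 n2 cd kc kd h1 h2.
have [a ca] : exists a, c = a + k.+1 by exists (c - k.+1); lia.
have [e de] : exists e, d = e + k.+1 by exists (d - k.+1); lia.
have [j kj] : exists j, k = j + 2 by exists (k - 2); lia.
subst c d k n. nia.
Qed.
Lemma count_three_parts (n k b m2 c d e : nat) : 2 <= k -> 2 * k + 2 <= n -> c + d + e
  = n ->
  0 < c -> 0 < d -> 0 < e -> c + 3 <= n -> d + 3 <= n -> e + 3 <= n ->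
  n ^ 2 <= m2 + 2 * b + (c ^ 2 + d ^ 2 + e ^ 2) -> b + k < k * 3 -> 
  6 * n <= m2 + 6 * k + 10.
Proof.
(* The number of pairs of vertices in different parts is at least [3 * n - 7] when at most one part
   is a singleton; [e'] stands for a part with two or more vertices. *)
have main c' d' e' : 0 < c' -> 0 < d' -> 1 < e' -> 2 < c' + d' ->
   3 * (c' + d' + e') <= c' * d' + (c' + d') * e' + 7.
  move=> c0 d0 e0 cd.
  have [x cx] : exists x, c' = x.+1 by exists c'.-1; lia.
  have [y cy] : exists y, d' = y.+1 by exists d'.-1; lia.
  have [z cz] : exists z, e' = z.+2 by exists e'.-2; lia.
  subst; nia.
move=> k2 n2 <- c0 d0 e0 c3 d3 e3 h1 h2.
have {main} : 3 * (c + d + e) <= c * d + (c + d) * e + 7.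
  have [e2|e2] := ltnP 1 e; first by apply: main; lia.
  have [d2|d2] := ltnP 1 d; last lia.
  have := main c e d; lia.
nia.
Qed.

(** * Missing edges forced by a bad partition *)

Section Counting.
Variable G : sgraph.
Implicit Types (x y z : G) (A : {set {set G}}) (C : {set G}).

(** Pairs are ordered, as in the double sums of quadratic forms: a missing edge counts twice. *)
Definition nonadj_pairs : {set G * G} := [set p | (p.1 != p.2) && ~~ adj p.1 p.2].

Lemma edge_pairs_le (Y : {set G * G}) (B : {set {set G}}) :
  (forall x y, (x, y) \in Y -> [set x; y] \in B) -> #|Y| <= 2 * #|B|.
Proof.
move=> YB; rewrite -sum1_card (partition_big (fun p => [set p.1; p.2]) (mem B)) /=;
  last first.
  by case=> x y; exact: YB.
rewrite mulnC -sum_nat_const; apply: leq_sum => e _; rewrite sum1dep_card.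
set Z := [set _ | _]; have [->|/set0Pn[[a b]]] := eqVneq Z finset.set0.
  by rewrite cards0.
rewrite inE /= => /andP[_ /eqP eE].
suff : Z \subset [set (a, b); (b, a)].
  by move=> /subset_leq_card /leq_trans; apply; rewrite cards2; case: (_ != _).
apply/fintype.subsetP => -[x y];
  rewrite !inE /= -eE => /andP[_ /eqP/eq_set2[[-> ->]|[-> ->]]];
by rewrite eqxx ?orbT.
Qed.

(** The side of [C] orients every crossing edge, so pairs map injectively to edges. *)
Lemma cut_le C (B : {set {set G}}) :
  (forall x y, x \in C -> y \notin C -> adj x y -> [set x; y] \in B) ->
  #|[set p : G * G | [&& p.1 \in C, p.2 \notin C & adj p.1 p.2]]| <= #|B|.
Proof.
move=> CB; set Y := [set p | _].
rewrite -(@card_in_imset _ _ (fun p : G * G => [set p.1; p.2]) Y).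
  apply: subset_leq_card; apply/fintype.subsetP => _ /imsetP[[x y] + ->].
  by rewrite inE /= => /and3P[xC yC xy]; exact: CB.
move=> [x y] [a b]; rewrite !inE /= => /and3P[xC yC _] /and3P[aC bC _].
by case/eq_set2 => -[xE yE]; subst => //; rewrite xC in bC.
Qed.

Lemma card_cross_pairs A :
  #|[set p : G * G | ~~ econn A p.1 p.2]| + \sum_(C in comps A) #|C| ^ 2 = #|G| ^ 2.
Proof.
have -> : \sum_(C in comps A) #|C| ^ 2 = #|[set p : G * G | econn A p.1 p.2]|.
  rewrite -[RHS]sum1dep_card -(pair_big_dep xpredT (econn A) (fun _ _ => 1)) /=.
  rewrite (partition_big (component A) (mem (comps A))) /=; last first.
    by move=> x _; exact: imset_f.
  apply: eq_bigr => C /imsetP[z _ ->].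
  rewrite (eq_bigr (fun=> #|component A z|)); last first.
    by move=> x /eqP <-; rewrite sum1dep_card.
  rewrite sum_nat_const; congr (_ * _); apply: eq_card => x; rewrite !inE.
  by transitivity (component A x == component A z) => //; rewrite eq_sym;
    apply/compP/eqP.
set Y := [set p | econn A _ _]; rewrite (_ : [set p | _] = ~: Y).
  by rewrite addnC cardsC card_prod mulnn.
by apply/setP => p; rewrite !inE.
Qed.

(** Sum of the inequalities [(s i - 1) * (M - s i) >= 0]. *)
Lemma sumsq_le (I : finType) (P : {set I}) (s : I -> nat) (M : nat) :
  (forall i, i \in P -> 0 < s i <= M) ->
  \sum_(i in P) s i ^ 2 + #|P| * M <= M.+1 * \sum_(i in P) s i.
Proof.
move=> sM; rewrite -sum_nat_const -big_split big_distrr /=.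
by apply: leq_sum => i /sM/andP[s_gt0 s_le]; nia.
Qed.

Section BadPartition.
Variables (k : nat) (A : {set {set G}}).
Hypothesis k_ge2 : 2 <= k.
Hypothesis n_ge : 2 * k + 2 <= #|G|.
Hypothesis deg_ge : forall x, k <= #|[set y | adj x y]|.
Hypothesis AE : A \subset edges G.
Local Notation B := (edges G :\: A).
Hypothesis A_bad : #|B| + k < k * ncomp A.
Local Notation n := #|G|.
Local Notation P := (comps A).

Lemma cross_edge x y : ~~ econn A x y -> adj x y -> [set x; y] \in B.
Proof.
by move=> nxy xy; rewrite !inE in_edges xy andbT; apply: contra nxy => /econn1.
Qed.

(** An ordered pair across two parts is either nonadjacent or one of the two orientations of an edge
    in [B]. *)
Lemma nonadj_pairs_ge : n ^ 2 <= #|nonadj_pairs| + 2 * #|B| + \sum_(C in P) #|C| ^ 2.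
Proof.
rewrite -(card_cross_pairs A) leq_add2r.
set X := [set p | _]; pose Y := [set p in X | adj p.1 p.2].
apply: (@leq_trans (#|nonadj_pairs| + #|Y|)); last first.
  rewrite leq_add2l; apply: edge_pairs_le => x y; rewrite !inE /= => /andP[nxy xy].
  by have := cross_edge nxy xy; rewrite !inE.
apply: leq_trans (leq_card_setU _ _); apply: subset_leq_card.
apply/fintype.subsetP => -[x y]; rewrite !inE /= => nxy; rewrite nxy /=.
case: (adj x y); rewrite /= ?orbT // andbT orbF.
by apply: contraNneq nxy => ->; exact: econn_refl.
Qed.

Lemma sum_comps : \sum_(C in P) #|C| = n.
Proof. by rewrite -(card_partition (comps_partition A)) cardsT. Qed.

Lemma comps_gt0 C : C \in P -> 0 < #|C|.
Proof.
by case/imsetP => x _ ->; apply/card_gt0P; exists x; rewrite inE econn_refl.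
Qed.

Lemma comps_le C : C \in P -> #|C| + ncomp A <= n.+1.
Proof.
move=> CP; rewrite -sum_comps (bigD1 C) //= /ncomp (cardsD1 C) CP add1n addnS ltnS.
rewrite leq_add2l -sum1_card [leqLHS](eq_bigl (fun D => (D \in P) && (D != C))).
  by apply: leq_sum => D /andP[/comps_gt0].
by move=> D; rewrite !inE andbC.
Qed.

(* A component with at most k vertices sends at least k edges outside. *)
Lemma comps_big C : C \in P -> #|B| < k -> k < #|C|.
Proof.
move=> CP Bk; rewrite ltnNge; apply/negP => Ck.
have C_gt0 := comps_gt0 CP; suff : k <= #|B| by rewrite leqNgt Bk.
case/imsetP: CP => z _ CE.
apply: (@leq_trans (#|[set p : G * G | [&& p.1 \in C, p.2 \notin C & adj p.1 p.2]]|));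
  last first.
  apply: cut_le => x y; rewrite CE !inE => zx nzy xy.
  have := cross_edge (x := x) (y := y); rewrite !inE; apply => //.
  by apply: contra nzy; exact: econn_trans.
rewrite -sum1dep_card -(pair_big_dep (mem C) (fun x y => (y \notin C) && adj x y) (fun
  _ _ => 1)) /=.
(* A vertex of [C] has at most [#|C| - 1] neighbours in [C], and [#|C| * (k + 1 - #|C|) >= k] for
   sizes from 1 to [k]. *)
apply: (@leq_trans (\sum_(x in C) (k.+1 - #|C|))).
  by rewrite sum_nat_const; nia.
apply: leq_sum => x xC; rewrite sum1dep_card.
set N := [set y | _]; have : [set y | adj x y] \subset N :|: (C :\ x).
  apply/fintype.subsetP => y; rewrite !inE => xy; rewrite xy andbT.
  by case: (y \in C); rewrite //= andbT eq_sym; exact: adj_neq.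
move=> /subset_leq_card/leq_trans/(_ (leq_card_setU _ _)).
have := deg_ge x; rewrite [X in _ <= _ + X](_ : _ = #|C|.-1); last first.
  by rewrite (cardsD1 x C) xC.
by move: C_gt0; lia.
Qed.

(** All edges at the two singletons cross, they share at most one edge, and at most [2 * k - 1]
    edges cross. With both degrees at least [k], this forces degrees [k] and a shared edge. *)
Lemma special_pair C D : ncomp A = 3 -> C \in P -> D \in P -> C != D ->
  #|C| = 1 -> #|D| = 1 ->
  exists u v : G, [/\ adj u v, #|[set y | adj u y]| = k & #|[set y | adj v y]| = k].
Proof.
move=> p3 CP DP CD /eqP/cards1P[u uC] /eqP/cards1P[v vD]; exists u, v.
have compE w E' : E' \in P -> w \in E' -> component A w = E'.
  by case/imsetP => z _ ->; rewrite inE => /compP.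
have uE : component A u = [set u] by rewrite (compE _ C) ?uC ?set11 // -uC.
have vE : component A v = [set v] by rewrite (compE _ D) ?vD ?set11 // -vD.
have uv : u != v by apply: contraNneq CD => uv; rewrite uC vD uv.
pose N (w : G) := [set [set w; y] | y in [set y | adj w y]].
have N_card w : #|N w| = #|[set y | adj w y]|.
  apply: card_in_imset => y z; rewrite !inE => wy wz /eq_set2[[]//|[wz' yw]].
  by rewrite yw wz'.
have NB w : component A w = [set w] -> N w \subset B.
  move=> wE; apply/fintype.subsetP => _ /imsetP[y + ->]; rewrite inE => wy.
  apply: cross_edge => //; apply/negP => wy'; have : y \in component A w by rewrite inE.
  by rewrite wE inE => /eqP yw; move: (adj_neq wy); rewrite yw eqxx.
have NI : N u :&: N v \subset [set [set u; v]].
  apply/fintype.subsetP => e; rewrite !inE => /andP[/imsetP[y _ ->] /imsetP[z _]].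
  by case/eq_set2 => [[uv']|[_ ->]] //; rewrite uv' eqxx in uv.
have := subset_leq_card (introT finset.subUsetP (conj (NB u uE) (NB v vE))).
rewrite cardsU !N_card; have := subset_leq_card NI; rewrite cards1.
have := deg_ge u; have := deg_ge v; move: A_bad; rewrite p3.
have numeric (b du dv i : nat) : b + k < k * 3 -> k <= dv -> k <= du -> i <= 1 -> du +
  dv - i <= b -> du = k /\ dv = k.
  lia.
case uv_adj: (adj u v).
  by move=> h1 h2 h3 h4 h5; have [] := numeric _ _ _ _ h1 h2 h3 h4 h5.
have -> : N u :&: N v = finset.set0.
  apply/eqP; rewrite -finset.subset0; apply/fintype.subsetP => e eI.
  have := fintype.subsetP NI e eI; move: eI; rewrite !inE => /andP[eu _] /eqP eE.
  case/imsetP: eu => y; rewrite inE eE => uy /eq_set2[[_ vy]|[uy' _]].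
    by rewrite vy uy in uv_adj.
  by move: (adj_neq uy); rewrite -uy' eqxx.
rewrite cards0 subn0 => h1 h2 h3 _ h5; have := leq_trans (leq_add h3 h2) h5.
by move: h1; move: #|B| => b; lia.
Qed.

Lemma bad_partition_count :
  (exists u v : G, [/\ adj u v, #|[set y | adj u y]| = k & #|[set y | adj v y]| = k])
  \/ 6 * n <= #|nonadj_pairs| + 6 * k + 10
  \/ n * (n - 1) + 2 <= #|nonadj_pairs| + 2 * k * (n - 1).
Proof.
have m2_ge := nonadj_pairs_ge; have sumP := sum_comps.
have [p_ge4|p_lt4] := leqP 4 (ncomp A).
  right; have p_le : ncomp A <= n by exact: ncomp_le.
  have M_le C : C \in P -> 0 < #|C| <= n.+1 - ncomp A.
    move=> CP; rewrite comps_gt0 //=; have := comps_le CP.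
    by rewrite leq_subRL 1?addnC // ltnW.
  have := sumsq_le M_le; rewrite sumP -/(ncomp A);
    apply: count_many_parts m2_ge A_bad => //.
  by rewrite p_ge4.
have p_gt1 : 1 < ncomp A.
  move: A_bad; case: (ncomp A) => [|[|//]]; first by rewrite muln0.
  by rewrite muln1 ltnNge leq_addl.
have pE : ncomp A = 2 \/ ncomp A = 3.
  by move: p_gt1 p_lt4; case: (ncomp A) => [|[|[|[|]]]] //; [left|right].
case: pE => pE; move: (A_bad); rewrite pE => Bk3.
  right; left; have /eqP/cards2P[C [D [CD PE]]] := pE.
  have Bk : #|B| < k by rewrite -(ltn_add2r k) addnn -muln2.
  have Ck : k < #|C| by apply: comps_big => //; rewrite PE set21.
  have Dk : k < #|D| by apply: comps_big => //; rewrite PE set22.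
  move: m2_ge sumP; rewrite PE !big_setU1 ?inE //= !big_set1 => h1 h2.
  exact: count_two_parts h2 Ck Dk h1 Bk.
have [C CP] : exists C, C \in P by apply/card_gt0P; rewrite -/(ncomp A) pE.
have /cards2P[D [H [DH PE]]] : #|P :\ C| == 2.
  by rewrite -(eqn_add2l 1) -[eqbRHS]pE /ncomp [eqbRHS](cardsD1 C) CP.
have := set21 D H; have := set22 D H; rewrite -PE !inE => /andP[HC HP] /andP[DC DP].
have P3E : P = C |: [set D; H] by rewrite -PE finset.setD1K.
have sumE (F : {set G} -> nat) : \sum_(X in P) F X = F C + F D + F H.
  rewrite P3E !big_setU1 ?inE ?negb_or //= ?big_set1 ?addnA //.
  by rewrite ![C == _]eq_sym DC HC.
move: m2_ge sumP; rewrite !sumE => h1 h2.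
have gt0C := comps_gt0 CP; have gt0D := comps_gt0 DP; have gt0H := comps_gt0 HP.
(* A part with more than [n - 3] vertices leaves two singletons. *)
have big X Y Z : X \in P -> Y \in P -> Z \in P -> Y != Z -> #|X| + #|Y| + #|Z| = n ->
    ~~ (#|X| + 3 <= n) ->
    exists u v : G, [/\ adj u v, #|[set y | adj u y]| = k & #|[set y | adj v y]| = k].
  move=> XP YP ZP YZ XYZ; rewrite -XYZ -addnA leq_add2l -ltnNge ltnS => YZ2.
  have := comps_gt0 YP; have := comps_gt0 ZP => Z0 Y0.
  apply: (special_pair pE YP ZP YZ); apply/eqP; rewrite eqn_leq ?Y0 ?Z0 andbT.
    by rewrite -(leq_add2r #|Z|) (leq_trans YZ2) // add1n.
  by rewrite -(leq_add2l #|Y|) (leq_trans YZ2) // addn1.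
have [C3|/(big C D H CP DP HP DH h2)] := boolP (#|C| + 3 <= n); last by left.
have h2' : #|D| + #|C| + #|H| = n by rewrite [#|D| + _]addnC.
have CH : C != H by rewrite eq_sym.
have [D3|/(big D C H DP CP HP CH h2')] := boolP (#|D| + 3 <= n); last by left.
have h2'' : #|H| + #|C| + #|D| = n by rewrite -addnA addnC.
have CD : C != D by rewrite eq_sym.
have [H3|/(big H C D HP CP DP CD h2'')] := boolP (#|H| + 3 <= n); last by left.
by right; left; exact: count_three_parts h2 gt0C gt0D gt0H C3 D3 H3 h1 Bk3.
Qed.
End BadPartition.

Lemma packing_or_count (k : nat) : 2 <= k -> 2 * k + 2 <= #|G| ->
  (forall x, k <= #|[set y | adj x y]|) -> k <= tau G \/
  [\/ exists u v : G, [/\ adj u v, #|[set y | adj u y]| = k & #|[set y | adj v y]| = k],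
      6 * #|G| <= #|nonadj_pairs| + 6 * k + 10
    | #|G| * (#|G| - 1) + 2 <= #|nonadj_pairs| + 2 * k * (#|G| - 1)].
Proof.
move=> k_ge2 n_ge deg_ge.
have G_gt1 : 1 < #|G| by apply: leq_trans n_ge; rewrite addn2.
have G_gt0 := ltnW G_gt1.
have [[F [F_tree F_disj]]|[A AE A_bad]] := tree_packing k (@edges_simple G) G_gt0.
  by left; exact: tau_ge F_tree F_disj.
right; have [|[|]] := bad_partition_count k_ge2 n_ge deg_ge AE A_bad.
- by constructor 1.
- by constructor 2.
- by constructor 3.
Qed.
End Counting.

(** * Graphs that are regular of degree 2 are unions of cycles *)

Section TwoRegular.
Variables (V : finType) (a : rel V).
Hypotheses (a_sym : symmetric a) (a_irr : irreflexive a).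
Hypothesis a_deg : forall x, #|[set y | a x y]| = 2.
Implicit Types (x y z : V) (c p : seq V) (U : {set V}).

Definition a_closed U := forall x y, x \in U -> a x y -> y \in U.

Definition long_cycle c := [&& 2 < size c, uniq c & cycle a c].

Lemma other_neighbor x y : exists2 z, a x z & z != y.
Proof.
have /eqP/cards2P[z1 [z2 [z12 NE]]] := a_deg x.
have az z : z \in [set z1; z2] -> a x z by rewrite -NE inE.
have [z1y|z1y] := eqVneq z1 y; last by exists z1; rewrite ?az ?set21.
by exists z2; rewrite ?az ?set22 // -z1y eq_sym.
Qed.

(** Prepend to the path a neighbour of [x] other than the second vertex. Since [V] is finite, such a
    neighbour eventually lies on the path; it then closes a cycle, of length at least 3 because it
    is not the second vertex. *)
Lemma long_cycle_extend U m x p : a_closed U -> #|V| <= m + size p ->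
  x \in U -> path a x p -> uniq (x :: p) -> {subset p <= U} ->
  exists2 c, long_cycle c & {subset c <= U}.
Proof.
move=> Ucl; elim: m x p => [|m IH] x p m_le xU xp xp_uniq pU.
  have := card_uniqP xp_uniq; have := max_card (mem (x :: p)) => /= le1 eq1.
  by move: le1; rewrite eq1 leqNgt ltnS m_le.
have [z xz z_neq] := other_neighbor x (head x p).
have zx : z != x by apply: contraTneq xz => ->; rewrite a_irr.
have [zp|zp] := boolP (z \in p); last first.
  apply: (IH z (x :: p)).
  - by rewrite addnS.
  - exact: Ucl xz.
  - by rewrite /= a_sym xz.
  - by rewrite [uniq _]/= inE negb_or zx zp.
  - by move=> y; rewrite inE => /predU1P[->//|/pU].
case/splitPr: zp z_neq xp xp_uniq pU => p1 p2 z_neq xp xp_uniq pU.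
exists (x :: rcons p1 z); last first.
  move=> y; rewrite inE => /predU1P[->//|yp]; apply: pU.
  by rewrite -cat_rcons mem_cat yp.
move: xp xp_uniq; rewrite -cat_rcons cat_path -cat_cons cat_uniq.
case/andP=> xp1 _ /and3P[u1 _ _]; apply/and3P; split=> //.
  by rewrite /= size_rcons; case: (p1) z_neq => //=; rewrite eqxx.
by rewrite /= rcons_path xp1 last_rcons a_sym.
Qed.

Lemma long_cycle_neq c x : long_cycle c -> x \in c -> next c x != prev c x.
Proof.
case/and3P => c_size c_uniq _ xc; apply/eqP => np.
have : next c (next c x) = x by rewrite np next_prev.
case/rot_to: xc c_size c_uniq => i s rotE; rewrite -(size_rot i) -(rot_uniq i) rotE.
move=> size_s uniq_s; have nE : next c =1 next (x :: s).
  by move=> y; rewrite -rotE next_rot // -(rot_uniq i) rotE.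
rewrite !nE; case: s size_s uniq_s {nE rotE} => [|y [|z s]] //= _.
rewrite eqxx !inE !negb_or => /andP[/and3P[xy xz _] _].
by rewrite eq_sym (negPf xy) eqxx => zx; rewrite zx eqxx in xz.
Qed.

(** The successor and the predecessor are two distinct neighbours, hence all of them. *)
Lemma long_cycle_adj c x y : long_cycle c -> x \in c ->
  a x y = (y == next c x) || (x == next c y).
Proof.
move=> lc xc; have np := long_cycle_neq lc xc; have /and3P[_ c_uniq c_cycle] := lc.
have sub : [set next c x; prev c x] \subset [set z | a x z].
  rewrite finset.subUset !finset.sub1set !inE next_cycle //=.
  by rewrite a_sym prev_cycle.
have /eqP NE : [set next c x; prev c x] == [set z | a x z].
  by rewrite finset.eqEcard sub a_deg cards2 np.
have -> : a x y = (y \in [set z | a x z]) by rewrite inE.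
rewrite -NE !inE; congr (_ || _); apply/eqP/eqP => [->|->].
  by rewrite next_prev.
by rewrite prev_next.
Qed.

Lemma long_cycle_closed c x y : long_cycle c -> x \in c -> a x y -> y \in c.
Proof.
move=> lc xc; rewrite (long_cycle_adj _ lc xc) => /orP[/eqP->|/eqP xE].
  by rewrite mem_next.
by rewrite -mem_next -xE.
Qed.

(** Remove one cycle and recurse: cycles are closed under adjacency, so the remainder of [U] is
    closed too. *)
Lemma cycle_cover U : a_closed U ->
  exists2 cs : seq (seq V), all long_cycle cs & uniq (flatten cs) /\ flatten cs =i U.
Proof.
move: {2}#|U| (leqnn #|U|) => m; elim: m U => [|m IH] U Um Ucl.
  exists [::] => //; split=> // x; rewrite in_nil; symmetry; apply/negP => xU.
  by move: Um; rewrite leqn0 cards_eq0 => /eqP U0; rewrite U0 inE in xU.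
have [->|/set0Pn[x xU]] := eqVneq U finset.set0.
  by exists [::] => //; split=> // x; rewrite in_nil finset.in_set0.
have [c lc cU] : exists2 c, long_cycle c & {subset c <= U}.
  by apply: (@long_cycle_extend U #|V| x [::]); rewrite ?leq_addr.
have c_gt0 : 0 < #|[set y in c]|.
  by case/and3P: lc; case: (c) => // y s _ _ _; apply/card_gt0P; exists y;
    rewrite !inE eqxx.
have [||cs cs_long [cs_uniq csE]] := IH (U :\: [set y in c]).
- rewrite -ltnS; apply: leq_trans Um; rewrite cardsD ltn_subrL.
  rewrite (finset.setIidPr _) ?c_gt0 /=; last first.
    by apply/fintype.subsetP => y; rewrite inE; exact: cU.
  by apply/card_gt0P; exists x.
- move=> y z; rewrite !inE => /andP[yc yU] yz; rewrite (Ucl y z) // andbT.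
  by apply: contra yc => zc; apply: long_cycle_closed lc zc _; rewrite a_sym.
exists (c :: cs); rewrite /= ?lc //; split.
  rewrite cat_uniq cs_uniq andbT; case/and3P: lc => _ -> _ /=.
  by apply/hasPn => y; rewrite csE !inE => /andP[].
move=> y; rewrite mem_cat csE !inE; case yc: (y \in c) => //=.
by rewrite cU.
Qed.

Lemma next_nth_ord c x0 i : uniq c -> i < size c ->
  next c (nth x0 c i) = nth x0 c (i.+1 %% size c).
Proof.
case: c => // y c uc ic; rewrite next_nth mem_nth // index_uniq //.
have [iE|ilt] : i = size c \/ i < size c by move: ic => /=;
  rewrite ltnS leq_eqVlt => /orP[/eqP|]; auto.
  by rewrite iE modnn nth_default.
by rewrite modn_small //=; exact: set_nth_default.
Qed.

End TwoRegular.

Lemma two_regular_co_cycles (G : sgraph) (n : nat) : #|G| = n -> 0 < n ->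
  (forall x : G, #|[set y | (x != y) && ~~ adj x y]| = 2) ->
  exists2 H : sgraph, co_cycles n H & isomorphic G H.
Proof.
move=> Gn n_gt0 deg2; pose a := @compl_adj G.
have a_sym : symmetric a by exact: compl_adj_sym.
have a_irr : irreflexive a by exact: compl_adj_irr.
have [//|cs cs_long [cs_uniq csE]] := @cycle_cover G a a_sym a_irr deg2 [set: G].
have [x0 _] : exists x : G, x \in G by apply/card_gt0P; rewrite Gn.
pose s := size cs; pose C (i : 'I_s) := nth [::] cs i; pose c i := size (C i).
have C_long i : long_cycle a (C i) by apply: (allP cs_long); exact: mem_nth.
pose g (u : dunion (fun i => cycle_graph (c i))) : G := nth x0 (C (tag u)) (tagged u).
have idx_lt (u : dunion (fun i => cycle_graph (c i))) :
    tagged u < nth 0 (shape cs) (tag u).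
  by rewrite (nth_map [::]) //; exact: ltn_ord.
(* Through positions in the duplicate-free [flatten cs], injectivity of [g] becomes that of the
   flattened index. *)
have gE u : g u = nth x0 (flatten cs) (flatten_index (shape cs) (tag u) (tagged u)).
  by rewrite nth_flatten flatten_indexKl // flatten_indexKr.
have g_inj : injective g.
  move=> u v; rewrite !gE => /eqP; rewrite nth_uniq //; try
    by rewrite size_flatten flatten_indexP.
  move=> /eqP uv; have := congr1 (reshape_index (shape cs)) uv.
  have := congr1 (reshape_offset (shape cs)) uv.
  rewrite !flatten_indexKl // !flatten_indexKr //.
  case: u v {uv} => [i x] [j y] /= xy /val_inj ij.
  by case: _ / ij y xy => y /val_inj ->.
have sumE : \sum_(i < s) c i = n.
  have -> : n = size (flatten cs).
    rewrite -(card_uniqP cs_uniq) -Gn -cardsT; apply: eq_card => x.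
    by rewrite csE !inE.
  by rewrite size_flatten sumnE big_map (big_nth [::]) big_mkord.
have card_u : #|dunion (fun i => cycle_graph (c i))| = n.
  rewrite card_tagged sumnE big_map big_enum /= -sumE.
  by apply: eq_bigr => i _; rewrite card_ord.
have g_bij : bijective g by apply: inj_card_bij => //; rewrite Gn card_u.
have mem_g u : g u \in C (tag u) by apply: mem_nth; exact: ltn_ord.
have g_adj u v : a (g u) (g v) = dunion_adj u v.
  rewrite /dunion_adj; case: eqP => [|/eqP uv] /=; last first.
    apply/negP => /(long_cycle_closed a_sym deg2 (C_long _) (mem_g u)) gv.
    have gvi := nth_index x0 gv; rewrite -index_mem in gv.
    have /g_inj vE : g v = g (existT _ (tag u) (Ordinal gv)) by [].
    by rewrite vE eqxx in uv.
  case: u v => [i x] [j y] /= ij; case: _ / ij y => y; rewrite tagged_asE.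
  have [_ C_uniq _] := and3P (C_long i).
  have aE : a (g (existT _ i x)) (g (existT _ i y)) =
      (y == ordS x) || (x == ordS y).
    rewrite (long_cycle_adj a_sym deg2 _ (C_long i) (mem_g (existT _ i x))).
    rewrite /g /= !next_nth_ord //.
    by rewrite !nth_uniq ?ltn_mod // (leq_ltn_trans _ (ltn_ord x)).
  rewrite aE /= /cycle_adj; case: (eqVneq x y) aE => //= <- <-.
  exact: a_irr.
have s_gt0 : 1 <= s.
  by rewrite lt0n; apply: contraTneq n_gt0 => s0; rewrite -sumE big1 // => i _;
    case: (notF); rewrite -(ltn0 i) -[X in _ < X]s0 ltn_ord.
exists (complement (dunion (fun i => cycle_graph (c i)))).
  by apply: CoCycles => // i; have /and3P[] := C_long i.
have [f fK gK] := g_bij; exists f; first by exists g.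
move=> x y; rewrite /= /compl_adj -[LHS]/((f x != f y) && ~~ dunion_adj (f x) (f y)).
rewrite -g_adj !gK (can_eq gK) /a /compl_adj.
by case: eqVneq => //= [->|_]; rewrite ?adj_irr // negbK.
Qed.

(** * Entrywise lower bounds for the distance matrix *)

Section LowerBounds.
Local Open Scope ring_scope.
Variables (R : realType) (G : sgraph).
Implicit Types (x y : G) (w : G -> R) (e : G -> G -> R).

(** The form of [e] at [w] lies between [mu] times the squared norm and the form of the distance
    matrix, which [mu] bounds in turn. All are equal, so [w] is an eigenvector, and positivity of
    [w] makes the equality hold entry by entry. *)
Lemma dist_rigidity w e (mu : R) :
  (forall x, 0 < w x) -> (forall x y, e x y <= (dist x y)%:R) ->
  dist_radius R G <= mu ->
  mu * (\sum_x w x ^+ 2) <= \sum_x w x * \sum_y e x y * w y ->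
  (forall x y, (dist x y)%:R = e x y) /\
  (forall x, \sum_y e x y * w y = mu * w x).
Proof.
move=> w_gt0 e_le rad_le form_ge.
have le_xy x y : 0 <= w x * ((dist x y)%:R * w y) - w x * (e x y * w y).
  by rewrite -mulrBr -mulrBl !mulr_ge0 ?subr_ge0 ?(ltW (w_gt0 _)).
have form_le : \sum_x w x * (\sum_y e x y * w y) <=
    \sum_x w x * (\sum_y (dist x y)%:R * w y).
  apply: ler_sum => x _; rewrite !mulr_sumr; apply: ler_sum => y _.
  by rewrite -subr_ge0.
have eig := dist_rayleigh rad_le (le_trans form_ge form_le).
have sum0 : \sum_x \sum_y (w x * ((dist x y)%:R * w y) - w x * (e x y * w y)) = 0.
  apply/eqP; rewrite eq_le sumr_ge0 ?andbT; last by move=> x _; exact: sumr_ge0.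
  under eq_bigr do rewrite sumrB -!mulr_sumr eig.
  rewrite sumrB subr_le0 (le_trans _ form_ge) // mulr_sumr ler_sum // => x _.
  by rewrite mulrCA expr2.
have distE x y : (dist x y)%:R = e x y.
  have rowx_ge0 z : true -> 0 <= \sum_t (w z * ((dist z t)%:R * w t) - w z * (e z t * w
    t)).
    by move=> _; exact: sumr_ge0.
  have /psumr_eq0P := psumr_eq0P rowx_ge0 sum0 (i := x) isT.
  move=> /(_ (fun t _ => le_xy x t))/(_ y isT)/eqP.
  rewrite -mulrBr -mulrBl !mulf_eq0 subr_eq0 (gt_eqF (w_gt0 x)) (gt_eqF (w_gt0 y)).
  by rewrite orbF => /eqP.
split=> // x; rewrite -eig; apply: eq_bigr => y _; by rewrite distE.
Qed.

Definition nadj x y : R := ((x != y) && ~~ adj x y)%:R.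

Lemma nadj_sym x y : nadj x y = nadj y x.
Proof. by rewrite /nadj eq_sym adj_sym. Qed.

Lemma nadj_ge0 x y : 0 <= nadj x y. Proof. exact: ler0n. Qed.

Lemma nadj_adj x y : adj x y -> nadj x y = 0.
Proof. by rewrite /nadj => ->; rewrite andbF. Qed.

Lemma nadjxx x : nadj x x = 0. Proof. by rewrite /nadj eqxx. Qed.

Lemma dist_ge_nadj x y : (x != y)%:R + nadj x y <= (dist x y)%:R.
Proof.
rewrite /nadj -natrD ler_nat; case: eqVneq => [->//|xy] /=.
case xy_adj: (adj x y); first by rewrite dist_adj.
by rewrite dist_nadj ?xy_adj // (card_gt1_neq xy).
Qed.

Lemma sum_neq w x : \sum_y (x != y)%:R * w y = \sum_y w y - w x.
Proof.
rewrite [in RHS](bigD1 x) //= addrAC subrr add0r [RHS]big_mkcond /=.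
by apply: eq_bigr => y _; rewrite eq_sym; case: eqP; rewrite /= ?mul0r ?mul1r.
Qed.

Lemma sum_delta w x : \sum_y (y == x)%:R * w y = w x.
Proof.
by rewrite (bigD1 x) //= eqxx mul1r big1 ?addr0 // => y /negPf ->; rewrite mul0r.
Qed.

Lemma sum_nadj x : \sum_y nadj x y = #|G|%:R - 1 - #|[set y | adj x y]|%:R.
Proof.
have -> : \sum_y nadj x y = \sum_y ((x != y)%:R - (adj x y)%:R).
  apply: eq_bigr => y _; rewrite /nadj; case: eqVneq => [->|_] /=.
    by rewrite adj_irr subr0.
  by case: adj; rewrite ?subrr ?subr0.
rewrite sumrB; congr (_ - _).
  have := sum_neq (fun=> 1) x; under eq_bigr do rewrite mulr1.
  by move=> ->; rewrite sumr_const.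
by rewrite -natr_sum -sum1dep_card [X in _ = X%:R]big_mkcond /=; congr _%:R.
Qed.

Lemma sum_nadj_pairs : \sum_x \sum_y nadj x y = #|nonadj_pairs G|%:R.
Proof.
by rewrite pair_bigA /= -natr_sum -sum1dep_card [X in _ = X%:R]big_mkcond.
Qed.

End LowerBounds.

Section WienerBound.
Local Open Scope ring_scope.
Variables (R : realType) (G : sgraph).

Lemma sum_dist_lower_row (x : G) :
  \sum_(y : G) ((x != y)%:R + nadj R x y) * 1 = #|G|%:R - 1 + \sum_y nadj R x y.
Proof.
under eq_bigr do rewrite mulrDl.
rewrite big_split /= (sum_neq (fun=> 1)) sumr_const; congr (_ + _).
by apply: eq_bigr => y _; rewrite mulr1.
Qed.

Lemma sum_dist_lower :
  \sum_(x : G) 1 * \sum_(y : G) ((x != y)%:R + nadj R x y) * 1 =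
  #|G|%:R * (#|G|%:R - 1) + #|nonadj_pairs G|%:R.
Proof.
rewrite -sum_nadj_pairs.
under eq_bigr do rewrite mul1r sum_dist_lower_row.
by rewrite big_split sumr_const /= -[RHS]/(_ + _) mulr_natl.
Qed.

Lemma dist_radius_average :
  #|G|%:R * (#|G|%:R - 1) + #|nonadj_pairs G|%:R <= dist_radius R G * #|G|%:R.
Proof.
(* If the constant vector beat the radius, rigidity with [mu] the radius itself would give equality,
   against strictness. *)
rewrite leNgt; apply/negP => lt.
have sum1 : \sum_(x : G) (1 : R) ^+ 2 = #|G|%:R.
  by under eq_bigr do rewrite expr1n; rewrite sumr_const.
have [||_ row] := @dist_rigidity R G (fun=> 1) _ _ _ (@dist_ge_nadj R G) (lexx _).
- by move=> x; exact: ltr01.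
- by rewrite sum1 sum_dist_lower ltW.
move: lt; rewrite -sum_dist_lower; under eq_bigr do rewrite row mulr1 mul1r.
by rewrite sumr_const mulr_natr ltxx.
Qed.
End WienerBound.

(** * Test vector for two adjacent vertices of degree k *)

Section SpecialPair.
Local Open Scope ring_scope.
Variables (R : realType) (G : sgraph) (u v : G) (k : nat) (L a : R).
Hypothesis uv_adj : adj u v.
Hypotheses (deg_u : #|[set y | adj u y]| = k) (deg_v : #|[set y | adj v y]| = k).
Implicit Types x y : G.
Local Notation na := (nadj R).
Local Notation n := (#|G|%:R : R).
Local Notation c := (n - 1 - k%:R).

(* An entrywise lower bound for the distance matrix that only sees u and v; on
   F_{n,k} it is the distance matrix. *)
Definition pair_dist x y : R :=
  (x != y)%:R + ((x == u)%:R * na u y + (x == v)%:R * na v y)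
              + ((y == u)%:R * na u x + (y == v)%:R * na v x).

(* Off u and v this is what the eigenvector equation of pair_dist for the
   eigenvalue L - 1 imposes, when the entries sum to 1; at u and v it is a. *)
Definition pair_weight x : R :=
  (1 + a * (na u x + na v x)) / L + (a - L^-1) * ((x == u)%:R + (x == v)%:R).

(** The number of vertices other than [u] and [v] adjacent to neither; it is [n - 2 * k] exactly
    when [u] and [v] have no common neighbour. *)
Definition common_nadj : R := \sum_x na u x * na v x.

Local Notation w := pair_weight.

Let vu : (v == u) = false.
Proof. by rewrite eq_sym; exact/negbTE/adj_neq. Qed.
Let uv : (u == v) = false. Proof. by rewrite eq_sym. Qed.
Let na_uv : na u v = 0. Proof. exact: nadj_adj. Qed.
Let na_vu : na v u = 0. Proof. by rewrite nadj_sym. Qed.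
Let na_idem (x y : G) : na x y * na x y = na x y.
Proof. by rewrite /nadj -natrM mulnb andbb. Qed.

(** No nonadjacent pair consists of [u] and [v], so [pair_dist] counts none twice; what it omits are
    the nonadjacent pairs avoiding both. *)
Lemma pair_distE x y :
  (x != y)%:R + na x y = pair_dist x y +
    ([&& x != u, x != v, y != u & y != v])%:R * na x y.
Proof.
rewrite /pair_dist -!addrA; congr (_ + _).
case: (eqVneq x u) => [->|xu]; case: (eqVneq y u) => [->|yu];
  rewrite ?vu ?uv ?nadjxx ?na_uv ?na_vu ?eqxx ?(negPf xu) ?(negPf yu) /=.
- by rewrite !(mul0r, mul1r, addr0, mulr0).
- case: (eqVneq y v) => [->|yv].
    by rewrite ?na_uv ?na_vu ?nadjxx !(mul0r, mul1r, addr0, mulr0).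
  by rewrite !(mul0r, mul1r, addr0, mulr0).
- case: (eqVneq x v) => [->|xv].
    by rewrite ?na_uv ?na_vu ?nadjxx !(mul0r, mul1r, addr0, mulr0).
  by rewrite !(mul0r, mul1r, addr0, mulr0, add0r) nadj_sym.
case: (eqVneq x v) => [->|xv]; case: (eqVneq y v) => [->|yv];
  rewrite ?nadjxx /= !(mul0r, mul1r, addr0, mulr0, add0r) //.
by rewrite nadj_sym.
Qed.

Lemma pair_dist_le x y : pair_dist x y <= (dist x y)%:R.
Proof.
apply: le_trans (dist_ge_nadj R x y); rewrite pair_distE lerDl.
by rewrite mulr_ge0 ?nadj_ge0.
Qed.

Lemma pair_weight_u : w u = a.
Proof.
by rewrite /pair_weight nadjxx na_vu eqxx uv /= !addr0 mulr0 addr0 mul1r mulr1 addrC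
  subrK.
Qed.

Lemma pair_weight_v : w v = a.
Proof.
by rewrite /pair_weight nadjxx na_uv eqxx vu /= !add0r mulr0 addr0 mul1r mulr1 addrC
  subrK.
Qed.

Lemma sum_nadj_u : \sum_x na u x = c. Proof. by rewrite sum_nadj deg_u. Qed.
Lemma sum_nadj_v : \sum_x na v x = c. Proof. by rewrite sum_nadj deg_v. Qed.

Lemma sum_eq_op (z : G) : \sum_x (x == z)%:R = 1 :> R.
Proof.
rewrite -[RHS](sum_delta (fun=> 1 : R) z).
by apply: eq_bigr => x _; rewrite mulr1.
Qed.

Lemma pair_count : 4 * c <= #|nonadj_pairs G|%:R.
Proof.
rewrite -sum_nadj_pairs.
have -> : 4 * c = \sum_x \sum_y (((x == u)%:R * na u y + (x == v)%:R * na v y)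
    + ((y == u)%:R * na u x + (y == v)%:R * na v x)).
  have row x : \sum_y (((x == u)%:R * na u y + (x == v)%:R * na v y)
      + ((y == u)%:R * na u x + (y == v)%:R * na v x)) =
      ((x == u)%:R * c + (x == v)%:R * c) + (na u x + na v x).
    rewrite !big_split /= -!mulr_sumr -!mulr_suml !sum_eq_op !mul1r.
    by rewrite sum_nadj_u sum_nadj_v.
  under eq_bigr do rewrite row.
  rewrite !big_split /= -!mulr_suml !sum_eq_op sum_nadj_u sum_nadj_v.
  by ring.
apply: ler_sum => x _; apply: ler_sum => y _.
have := pair_distE x y; rewrite /pair_dist -!addrA => /addrI ->.
by rewrite !addrA lerDl mulr_ge0 ?nadj_ge0.
Qed.

Hypothesis L_gt0 : 0 < L.
Hypothesis a_gt0 : 0 < a.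
Hypothesis eq_sum : L * (1 - 2 * a) = n - 2 + 2 * a * c.

Lemma pair_weight_gt0 x : 0 < w x.
Proof.
have [->|xu] := eqVneq x u; first by rewrite pair_weight_u.
have [->|xv] := eqVneq x v; first by rewrite pair_weight_v.
rewrite /pair_weight (negPf xu) (negPf xv) addr0 mulr0 addr0 divr_gt0 //.
apply: ltr_wpDr => //; apply: mulr_ge0; first exact: ltW.
by rewrite addr_ge0 ?nadj_ge0.
Qed.

(** Multiplied by [L], this normalization is [eq_sum]. *)
Lemma sum_pair_weight : \sum_x w x = 1.
Proof.
rewrite /pair_weight big_split /= -mulr_suml -mulr_sumr !big_split /= -mulr_sumr.
rewrite big_split /= sum_nadj_u sum_nadj_v !sum_eq_op sumr_const -mulr_natl mulr1.
have L_neq0 : L != 0 by rewrite gt_eqF.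
apply: (mulIf L_neq0); rewrite mulrDl divfK // -mulrA mul1r.
have -> : (a - L^-1) * ((1 + 1) * L) = 2 * a * L - 2 by field.
by rewrite -[RHS](subrK (2 * a * L)); move: eq_sum; lra.
Qed.

Lemma sum_nadj_weight z : z = u \/ z = v ->
  \sum_y na z y * w y = (c + a * (c + common_nadj)) / L.
Proof.
move=> zE; have z0 y : na z y * ((y == u)%:R + (y == v)%:R) = 0.
  case: (eqVneq y u) => [->|_]; first by case: zE => ->; rewrite ?nadjxx ?na_vu mul0r.
  case: (eqVneq y v) => [->|_]; first by case: zE => ->; rewrite ?nadjxx ?na_uv mul0r.
  by rewrite addr0 mulr0.
have sqE y : na z y * (na u y + na v y) = na z y + na u y * na v y.
  case: zE => ->; rewrite mulrDr na_idem //.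
  by rewrite addrC mulrC.
transitivity (\sum_y (na z y + a * (na z y + na u y * na v y)) / L).
  apply: eq_bigr => y _; rewrite /pair_weight mulrDr [X in _ + X]mulrCA z0 mulr0 addr0.
  by rewrite mulrA mulrDr mulr1 mulrCA sqE.
rewrite -mulr_suml big_split /= -mulr_sumr big_split /=.
by case: zE => ->; rewrite ?sum_nadj_u ?sum_nadj_v.
Qed.

Lemma pair_dist_row x :
  \sum_y pair_dist x y * w y =
  1 - w x + ((x == u)%:R + (x == v)%:R) * ((c + a * (c + common_nadj)) / L)
    + a * (na u x + na v x).
Proof.
have -> : \sum_y pair_dist x y * w y = \sum_y ((x != y)%:R * w y)
    + ((x == u)%:R * (\sum_y na u y * w y) + (x == v)%:R * (\sum_y na v y * w y))
    + (na u x * (\sum_y (y == u)%:R * w y) + na v x * (\sum_y (y == v)%:R * w y)).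
  rewrite !mulr_sumr -!big_split /=; apply: eq_bigr => y _.
  by rewrite /pair_dist; ring.
rewrite sum_neq sum_pair_weight !sum_delta pair_weight_u pair_weight_v.
rewrite !sum_nadj_weight; [|by right|by left].
by ring.
Qed.

Hypothesis eq_u : L ^+ 2 * a = L + c * (1 + a) + a * (n - 2 * k%:R).

(** [eq_u] is the eigenvector equation at [u] when [common_nadj] equals [n - 2 * k], as on F_{n,k}.
    In general the defect at [u] and [v] is proportional to the excess of [common_nadj] over this
    value. *)
Lemma pair_dist_eigen x :
  \sum_y pair_dist x y * w y = (L - 1) * w x
    + ((x == u)%:R + (x == v)%:R) * (a * (common_nadj - (n - 2 * k%:R)) / L).
Proof.
have L_neq0 : L != 0 by rewrite gt_eqF.
have row_uE : (c + a * (c + common_nadj)) / L =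
    L * a - 1 + a * (common_nadj - (n - 2 * k%:R)) / L.
  apply: (mulIf L_neq0); rewrite divfK // [RHS]mulrDl divfK //.
  have -> : (L * a - 1) * L = L ^+ 2 * a - L by ring.
  rewrite eq_u; ring.
rewrite pair_dist_row row_uE.
have [->|xu] := eqVneq x u.
  by rewrite uv pair_weight_u nadjxx na_vu /=; ring.
have [->|xv] := eqVneq x v.
  by rewrite pair_weight_v nadjxx na_uv /=; ring.
by rewrite /pair_weight (negPf xu) (negPf xv) /= !addr0 mulr0 addr0 !mul0r addr0; field.
Qed.

(** Inclusion and exclusion; the right side counts the common neighbours of [u] and [v]. *)
Lemma card_nadj_union :
  n - 2 - 2 * c + common_nadj =
  #|[set x | [&& x != u, x != v & (na u x == 0) && (na v x == 0)]]|%:R.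
Proof.
rewrite -sum1dep_card natr_sum big_mkcond /=.
have -> : n - 2 - 2 * c + common_nadj =
  \sum_x (1 - (x == u)%:R - (x == v)%:R - na u x - na v x + na u x * na v x).
  rewrite !big_split /= !sumrN sumr_const !sum_eq_op sum_nadj_u sum_nadj_v
    -/common_nadj.
  by rewrite -[1 *+ _]/n; ring.
apply: eq_bigr => x _.
have na01 z : na z x = 0 \/ na z x = 1.
  by rewrite /nadj; case: (_ && _); [right|left].
have [->|xu] := eqVneq x u; first by rewrite uv nadjxx na_vu /=; ring.
have [->|xv] := eqVneq x v; first by rewrite nadjxx na_uv /=; ring.
have n10 : (1 == 0 :> R) = false by exact: oner_eq0.
by case: (na01 u) => ->; case: (na01 v) => ->; rewrite ?eqxx ?n10 /=; ring.
Qed.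

Lemma common_nadj_ge : n - 2 * k%:R <= common_nadj.
Proof.
have := ler0n R #|[set x | [&& x != u, x != v & (na u x == 0) && (na v x == 0)]]|.
by rewrite -card_nadj_union; lra.
Qed.

End SpecialPair.

(** * The cubic equation behind the radius of F_{n,k} *)

Section Cubic.
Local Open Scope ring_scope.
Variables (R : realType) (n k : nat).
Hypotheses (k_ge2 : (2 <= k)%N) (n_ge : (2 * k + 3 <= n)%N).
Local Notation N := (n%:R : R).
Local Notation K := (k%:R : R).
Local Notation c := (N - 1 - K).

(* Eliminating a from the two equations of exists_perron_pair. *)
Definition radius_cubic (x : R) : R :=
  (x - N + 2) * (x ^+ 2 - c - (N - 2 * K)) - 2 * (x + c) ^+ 2.

Lemma radius_cubic_gt0 : 0 < radius_cubic (N + 6 - (6 * K + 10) / N).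
Proof.
have N_gt0 : 0 < N by rewrite ltr0n; lia.
have N_neq0 : N != 0 by rewrite gt_eqF.
rewrite -(pmulr_lgt0 _ (exprn_gt0 3 N_gt0)) /radius_cubic.
(* In the slacks [j] of [k >= 2] and [m] of [n >= 2 * k + 3], the value multiplied by [N ^ 3] is a
   polynomial with positive coefficients only. *)
have [j kE] : exists j, k = (2 + j)%N by exists (k - 2)%N; lia.
have [m nE] : exists m, n = (2 * j + 7 + m)%N by exists (n - (2 * j + 7))%N; lia.
set M := N ^+ 2 + 6 * N - 6 * K - 10.
have -> : ((N + 6 - (6 * K + 10) / N - N + 2) *
     ((N + 6 - (6 * K + 10) / N) ^+ 2 - c - (N - 2 * K)) -
     2 * (N + 6 - (6 * K + 10) / N + c) ^+ 2) * N ^+ 3 =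
   (M - N ^+ 2 + 2 * N) * (M ^+ 2 - (c + N - 2 * K) * N ^+ 2) - 2 * N * (M + c * N) ^+
     2.
  by rewrite /M; field.
have NE : N = 2 * j%:R + 7 + m%:R by rewrite nE 2!natrD natrM.
have KE : K = 2 + j%:R by rewrite kE natrD.
rewrite /M NE KE; move: (ler0n R j) (ler0n R m).
move: (j%:R : R) (m%:R : R) => x y x_ge0 y_ge0.
rewrite [ltRHS](_ : _ = (184 * 100 + 86) + (
    (195 * 100 + 6) * y + (67 * 100) * y ^+ 2 + 882 * y ^+ 3 + 34 * y ^+ 4
    + (246 * 100 + 58) * x + (182 * 100 + 80) * x * y + (39 * 100 + 80) *
    x * y ^+ 2 + 256 * x * y ^+ 3 + 2 * x * y ^+ 4 + (127 * 100 + 4) * x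
    ^+ 2 + (61 * 100 + 10) * x ^+ 2 * y + 708 * x ^+ 2 * y ^+ 2 + 14 * x
    ^+ 2 * y ^+ 3 + (31 * 100 + 40) * x ^+ 3 + 848 * x ^+ 3 * y + 36 * x
    ^+ 3 * y ^+ 2 + 368 * x ^+ 4 + 40 * x ^+ 4 * y + 16 * x ^+ 5)); last by ring.
apply: ltr_pwDl; first lra.
repeat match goal with
| |- is_true (0 <= _ + _) => apply: addr_ge0
| |- is_true (0 <= _ * _) => apply: mulr_ge0
| |- is_true (0 <= _ ^+ _) => apply: exprn_ge0
| |- is_true (0 <= _%:R) => exact: ler0n
| _ => assumption
end.
Qed.

(* L - 1 is the distance spectral radius of F_{n,k}, and a is the value at u
   and v of the Perron vector whose entries sum to 1. *)
Lemma exists_perron_pair : exists L a : R,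
  [/\ 0 < L, 0 < a, L * (1 - 2 * a) = N - 2 + 2 * a * c,
      L ^+ 2 * a = L + c * (1 + a) + a * (N - 2 * K) &
      (L - 1) * N < N * (N - 1) + 6 * N - 6 * K - 10].
Proof.
have K_ge2 : 2 <= K by rewrite ler_nat.
have N_ge : 2 * K + 3 <= N by rewrite -natrM -natrD ler_nat.
have N_gt0 : 0 < N by lra.
set b := N + 6 - (6 * K + 10) / N.
have bN : b * N = N ^+ 2 + 6 * N - 6 * K - 10.
  by rewrite /b; field; rewrite gt_eqF.
have N_lt_b : N < b.
  by rewrite -(ltr_pM2r N_gt0) bN; lra.
have evalE (d e f g x : R) :
    (('X - d%:P) * ('X ^+ 2 - e%:P) - g%:P * ('X + f%:P) ^+ 2).[x] =
    (x - d) * (x ^+ 2 - e) - g * (x + f) ^+ 2.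
  by rewrite !(hornerE, horner_exp).
pose p : {poly R} := ('X - (N - 2)%:P) * ('X ^+ 2 - (c + (N - 2 * K))%:P)
  - 2%:P * ('X + c%:P) ^+ 2.
have pE x : p.[x] = radius_cubic x by rewrite evalE /radius_cubic; ring.
have cubicN : radius_cubic N <= 0.
  by rewrite /radius_cubic; nra.
(* The cubic is nonpositive at [N] and positive at [b], so it has a root [L] with [N <= L < b]. *)
have [|L /andP[N_le_L L_le_b]] := poly_ivt (ltW N_lt_b) (p := p).
  by rewrite !pE cubicN ltW ?radius_cubic_gt0.
rewrite /root pE => /eqP L_root.
have L_lt_b : L < b.
  rewrite lt_neqAle L_le_b andbT; apply/eqP => Lb.
  by have := radius_cubic_gt0; rewrite -/b -Lb L_root ltxx.
have den_gt0 : 0 < L ^+ 2 - c - (N - 2 * K) by nra.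
(* The equation [L ^+ 2 * a = ...] is linear in [a] and gives this value; the other equation then
   says that [L] is a root of the cubic. *)
exists L, ((L + c) / (L ^+ 2 - c - (N - 2 * K))).
set a := _ / _; have aE : a * (L ^+ 2 - c - (N - 2 * K)) = L + c.
  by rewrite divfK // gt_eqF.
split.
- by lra.
- by rewrite divr_gt0 //; lra.
- apply: (mulIf (lt0r_neq0 den_gt0)); move: L_root aE; rewrite /radius_cubic.
  set D := L ^+ 2 - _ - _ => L_root aE.
  have : (L - N + 2) * D = 2 * (L + c) * (a * D) by rewrite aE; move: L_root; lra.
  lra.
- by move: aE; lra.
- by move: L_lt_b; rewrite -(ltr_pM2r N_gt0) bN; lra.
Qed.
End Cubic.

(** * Bijections preserving vertex classes *)

Lemma card_color_classes (A : finType) (h : A -> nat) (m : nat) :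
  (forall x, h x < m) -> #|A| = \sum_(i < m) #|[set x | h x == i]|.
Proof.
move=> h_lt; under eq_bigr do rewrite -sum1dep_card.
by rewrite -sum1_card (partition_big (fun x => Ordinal (h_lt x)) xpredT).
Qed.

Lemma colored_bijection (A B : finType) (cA : A -> nat) (cB : B -> nat) (m : nat) :
  B -> #|A| = #|B| -> (forall x, cA x < m.+1) -> (forall y, cB y < m.+1) ->
  (forall i, i < m -> #|[set x | cA x == i]| = #|[set y | cB y == i]|) ->
  exists2 f : A -> B, bijective f & forall x, cB (f x) = cA x.
Proof.
move=> y0 AB cA_lt cB_lt fibers.
have fiber i : i < m.+1 -> #|[set x | cA x == i]| = #|[set y | cB y == i]|.
  (* The last class has equal size on both sides because the totals and all other classes agree. *)
  rewrite ltnS leq_eqVlt => /predU1P[->|/fibers//].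
  move: AB; rewrite (card_color_classes cA_lt) (card_color_classes cB_lt).
  rewrite !big_ord_recr /=; under eq_bigr do rewrite fibers //.
  exact: addnI.
pose EA i := enum [set x | cA x == i]; pose EB i := enum [set y | cB y == i].
have size_E i : i < m.+1 -> size (EA i) = size (EB i) by move=> /fiber; rewrite !cardE.
pose f x := nth y0 (EB (cA x)) (index x (EA (cA x))).
have idx x : index x (EA (cA x)) < size (EB (cA x)).
  by rewrite -size_E // index_mem /EA mem_enum inE.
have fE x : cB (f x) = cA x.
  have : f x \in EB (cA x) by exact: mem_nth.
  by rewrite /EB mem_enum inE => /eqP.
exists f => //; apply: inj_card_bij; last by rewrite AB.
move=> x x' ff; have cx : cA x = cA x' by rewrite -!fE ff.
have /eqP := ff; rewrite /f -cx nth_uniq ?idx ?enum_uniq //; last first.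
  by rewrite cx idx.
have memEA z : z \in EA (cA z) by rewrite /EA mem_enum inE.
have x'E : x' \in EA (cA x) by rewrite cx.
by move=> /eqP ixE; rewrite -[LHS](nth_index x (memEA x)) ixE nth_index.
Qed.

(** * Distances and radius of F_{n,k} *)

Section FGraphFacts.
Variables (m k : nat) (S T : {set 'I_m}).
Hypotheses (k_ge2 : 2 <= k) (ST : [disjoint S & T]).
Hypotheses (S_card : #|S| = k - 1) (T_card : #|T| = k - 1).
Local Notation F := (F_graph S T).
Local Notation "'u" := (inr true : F).
Local Notation "'v" := (inr false : F).

Lemma F_card : #|F| = m + 2.
Proof. by rewrite card_sum card_ord card_bool. Qed.

Lemma F_degree (b : bool) : #|[set y : F | adj (inr b : F) y]| = k.
Proof.
have -> : [set y : F | adj (inr b : F) y] =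
    inr (~~ b) |: [set inl i | i in if b then S else T].
  apply/setP => -[i|c]; rewrite !inE /=.
    by rewrite (mem_imset _ _ (@inl_inj _ _)).
  by case: imsetP => [[]//|_]; rewrite orbF; case: b c => [] [].
rewrite cardsU1 card_imset; last exact: inl_inj.
by case: imsetP => [[]//|_]; case: b; rewrite ?S_card ?T_card /= subnKC // ltnW.
Qed.

(** The diameter is at most two: as [k >= 2], both [S] and [T] are nonempty, and any of their
    members links [u] or [v] to the rest of the clique. *)
Lemma F_dist (R : realType) (x y : F) :
  ((dist x y)%:R = (x != y)%:R + nadj R x y)%R.
Proof.
rewrite /nadj -natrD; congr _%:R%R.
case: eqVneq => [->|xy]; first by rewrite dist_xx.
rewrite [_ && _]andTb; case xy_adj: (adj x y); first by rewrite dist_adj.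
have S_gt0 (b : bool) : exists i, i \in if b then S else T.
  by apply/card_gt0P; case: b; rewrite ?S_card ?T_card subn_gt0.
have common i b : i \notin (if b then S else T) ->
    exists s : 'I_m, i != s /\ s \in if b then S else T.
  move=> ib; have [s sb] := S_gt0 b; exists s; split=> //.
  by apply: contraNneq ib => ->.
case: x y xy xy_adj => [i|b] [j|c] xy xy_adj.
- by move: xy_adj xy => /= /negbFE/eqP ->; rewrite eqxx.
- have [s [si sc]] := common i c (negbT xy_adj).
  by apply: (@dist_common F _ _ (inl s : F)); rewrite ?xy_adj.
- have [s [si sc]] := common j b (negbT xy_adj).
  by apply: (@dist_common F _ _ (inl s : F)); rewrite ?xy_adj //= eq_sym.
by move: xy_adj xy => /= /negbFE/eqP ->; rewrite eqxx.
Qed.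

Lemma F_pair_dist (R : realType) (x y : F) :
  ((dist x y)%:R = pair_dist R 'u 'v x y)%R.
Proof.
rewrite F_dist (@pair_distE R F 'u 'v isT).
case: x y => [i|[]] [j|[]]; rewrite /= ?mul0r ?addr0 //.
rewrite /nadj (inj_eq (@inl_inj _ _)) -[adj _ _]/(i != j).
by case: eqP; rewrite /= mulr0 addr0.
Qed.

(** Disjointness of [S] and [T] removes the defect in [pair_dist_eigen], so [pair_weight] is a
    positive eigenvector for [L - 1], which then bounds every eigenvalue. *)
Lemma F_dist_radius_le (R : realType) (L a : R) :
  let n : R := #|F|%:R%R in let c : R := (n - 1 - k%:R)%R in
  (0 < L)%R -> (0 < a)%R -> (L * (1 - 2 * a) = n - 2 + 2 * a * c)%R ->
  (L ^+ 2 * a = L + c * (1 + a) + a * (n - 2 * k%:R))%R ->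
  (dist_radius R F <= L - 1)%R.
Proof.
move=> n c L_gt0 a_gt0 eq_sum eq_u.
have uv : adj ('u) ('v) by [].
have du := F_degree true; have dv := F_degree false.
have common : (common_nadj R 'u 'v = n - 2 * k%:R)%R.
  have /eqP := card_nadj_union R uv du dv.
  rewrite -/n (_ : #|_| = 0); first by move/eqP; rewrite /n; lra.
  apply: eq_card0 => -[i|[]]; rewrite !inE //= /nadj /= !pnatr_eq0 !eqb0 !negbK.
  apply/negP => /andP[iS iT].
  by move/pred0P/(_ i): ST; rewrite /= iS iT.
apply: (dist_radius_le (w := pair_weight 'u 'v L a)).
- by rewrite F_card addn2.
- by move=> x; exact: pair_weight_gt0.
move=> x; under eq_bigr do rewrite F_pair_dist.
rewrite (pair_dist_eigen uv du dv L_gt0 eq_sum eq_u) common.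
by rewrite subrr !(mulr0, mul0r) addr0.
Qed.
End FGraphFacts.

(* Both F_{n,k} and the graphs to be identified with it are determined by the
   classes {u}, {v}, S, T and the rest, numbered from 0 to 4. *)
Definition class_adj (c d : nat) : bool :=
  match c, d with
  | 0, 1 | 1, 0 | 0, 2 | 2, 0 | 1, 3 | 3, 1 => true
  | 0, _ | 1, _ | _, 0 | _, 1 => false
  | _, _ => true
  end.

Definition F_class (m : nat) (S T : {set 'I_m}) (x : 'I_m + bool) : nat :=
  match x with
  | inr true => 0
  | inr false => 1
  | inl i => if i \in S then 2 else if i \in T then 3 else 4
  end.

Lemma F_adj_class (m : nat) (S T : {set 'I_m}) (x y : 'I_m + bool) :
  [disjoint S & T] ->
  F_adj S T x y = (x != y) && class_adj (F_class S T x) (F_class S T y).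
Proof.
move=> /pred0P ST; case: x y => [i|b] [j|c] /=.
- rewrite (inj_eq (@inl_inj _ _)).
  by case: (i \in S); case: (i \in T); case: (j \in S); case: (j \in T); rewrite andbT.
- by have := ST i; case: c => /=; case: (i \in S); case: (i \in T).
- by have := ST j; case: b => /=; case: (j \in S); case: (j \in T).
by case: b c => [] [].
Qed.

(** * Recognition of F_{n,k} *)

Section SpecialIsomorphism.
Variables (m k : nat) (S T : {set 'I_m}) (G : sgraph) (u v : G).
Hypotheses (ST : [disjoint S & T]) (S_card : #|S| = k - 1) (T_card : #|T| = k - 1).
Hypotheses (G_card : #|G| = m + 2) (uv : adj u v).
Hypotheses (deg_u : #|[set y | adj u y]| = k) (deg_v : #|[set y | adj v y]| = k).
Hypothesis no_common : forall x, adj u x -> ~~ adj v x.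
Hypothesis rest_adj : forall x y, [&& x != u, x != v, y != u & y != v] ->
  x != y -> adj x y.

Definition pair_class (x : G) : nat :=
  if x == u then 0 else if x == v then 1 else
  if adj u x then 2 else if adj v x then 3 else 4.

Lemma pair_class_adj (x y : G) :
  adj x y = (x != y) && class_adj (pair_class x) (pair_class y).
Proof.
have [<-|xy] := eqVneq x y; first by rewrite adj_irr.
have vu : (v == u) = false by rewrite eq_sym; exact/negbTE/adj_neq.
rewrite /pair_class andTb.
have [xu|xu] := eqVneq x u; have [yu|yu] := eqVneq y u.
- by rewrite xu yu eqxx in xy.
- rewrite xu; have [->|yv] := eqVneq y v; first by rewrite uv.
  by case: (adj u y) => //; case: (adj v y).
- rewrite yu adj_sym; have [->|xv] := eqVneq x v; first by rewrite uv.
  by case: (adj u x) => //; case: (adj v x).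
have [xv|xv] := eqVneq x v; have [yv|yv] := eqVneq y v.
- by rewrite xv yv eqxx in xy.
- rewrite xv; case uy: (adj u y); last by case: (adj v y).
  by rewrite (negbTE (no_common uy)).
- rewrite yv adj_sym; case ux: (adj u x); last by case: (adj v x).
  by rewrite (negbTE (no_common ux)).
rewrite rest_adj ?xu ?xv ?yu ?yv //.
by case: (adj u x); case: (adj v x); case: (adj u y); case: (adj v y).
Qed.

(** Distinct vertices are adjacent according to their classes alone, and in both graphs the first
    four classes have sizes 1, 1, [k - 1], [k - 1]. Any class-preserving bijection is therefore an
    isomorphism. *)
Lemma special_isomorphic : isomorphic G (F_graph S T).
Proof.
have vu : (v == u) = false by rewrite eq_sym; exact/negbTE/adj_neq.
have [] := @colored_bijection G (F_graph S T) pair_class (F_class S T) 4 (inr true).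
- by rewrite F_card.
- move=> x; rewrite /pair_class; case: (x == u); case: (x == v) => //.
  by case: (adj u x); case: (adj v x).
- by move=> [i|[]] //=; case: (i \in S); case: (i \in T).
- move=> [|[|[|[|//]]]] _.
  + rewrite (_ : [set x | _] = [set u]); last first.
      apply/setP => x; rewrite !inE /pair_class.
      case: (x == u) => //.
      by case: (x == v); case: (adj u x); case: (adj v x).
    rewrite (_ : [set y | _] = [set inr true]) ?cards1 //.
    by apply/setP => -[i|[]]; rewrite !inE //=; case: (i \in S); case: (i \in T).
  + rewrite (_ : [set x | _] = [set v]); last first.
      apply/setP => x; rewrite !inE /pair_class.
      case: (eqVneq x u) => [->|_]; first by rewrite [u == v]eq_sym vu.
      by case: (x == v); case: (adj u x); case: (adj v x).
    rewrite (_ : [set y | _] = [set inr false]) ?cards1 //.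
    by apply/setP => -[i|[]]; rewrite !inE //=; case: (i \in S); case: (i \in T).
  + rewrite (_ : [set x | _] = [set y | adj u y] :\ v); last first.
      apply/setP => x; rewrite !inE /pair_class.
      case: (eqVneq x u) => [->|_]; first by rewrite adj_irr andbF.
      by case: (x == v) => //=; case: (adj u x) => //; case: (adj v x).
    rewrite (_ : [set y | _] = [set inl i | i in S]); last first.
      apply/setP => -[i|[]]; rewrite !inE /=; last 2 first.
      * by symmetry; apply/negbTE/imsetP => -[].
      * by symmetry; apply/negbTE/imsetP => -[].
      rewrite (mem_imset _ _ (@inl_inj _ _)); case: (i \in S) => //.
      by case: (i \in T).
    rewrite card_imset; last exact: inl_inj.
    by rewrite S_card -deg_u [in RHS](cardsD1 v) inE uv addnC addnK.
  + rewrite (_ : [set x | _] = [set y | adj v y] :\ u); last first.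
      apply/setP => x; rewrite !inE /pair_class.
      case: (eqVneq x u) => //= _.
      case: (eqVneq x v) => [->|_]; first by rewrite adj_irr.
      case ux: (adj u x); first by rewrite (negbTE (no_common ux)).
      by case: (adj v x).
    rewrite (_ : [set y | _] = [set inl i | i in T]); last first.
      apply/setP => -[i|[]]; rewrite !inE /=; last 2 first.
      * by symmetry; apply/negbTE/imsetP => -[].
      * by symmetry; apply/negbTE/imsetP => -[].
      rewrite (mem_imset _ _ (@inl_inj _ _)); move/pred0P/(_ i): ST => /=.
      by case: (i \in S); case: (i \in T).
    rewrite card_imset; last exact: inl_inj.
    by rewrite T_card -deg_v [in RHS](cardsD1 u) inE adj_sym uv addnC addnK.
move=> f f_bij f_class; exists f => // x y.
rewrite -[LHS]/(F_adj S T (f x) (f y)) F_adj_class // !f_class pair_class_adj.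
by rewrite (inj_eq (bij_inj f_bij)).
Qed.
End SpecialIsomorphism.

(** * Equality case and the theorem *)

Section Conclusion.
Variables (R : realType) (k : nat) (G : sgraph).
Local Open Scope ring_scope.

Lemma special_radius_isomorphic (m : nat) (S T : {set 'I_m}) (u v : G) (L a : R) :
  let n : R := #|G|%:R in let c : R := n - 1 - k%:R in
  0 < L -> 0 < a -> L * (1 - 2 * a) = n - 2 + 2 * a * c ->
  L ^+ 2 * a = L + c * (1 + a) + a * (n - 2 * k%:R) ->
  [disjoint S & T] -> #|S| = (k - 1)%N -> #|T| = (k - 1)%N -> #|G| = (m + 2)%N ->
  adj u v -> #|[set y | adj u y]| = k -> #|[set y | adj v y]| = k ->
  dist_radius R G <= L - 1 -> isomorphic G (F_graph S T).
Proof.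
move=> n c L_gt0 a_gt0 eq_sum eq_u ST S_card T_card G_card uv du dv rad_le.
have w_gt0 := pair_weight_gt0 uv L_gt0 a_gt0.
have eig := pair_dist_eigen uv du dv L_gt0 eq_sum eq_u.
have common_ge := common_nadj_ge R uv du dv.
have [|distE rowE] := dist_rigidity w_gt0 (pair_dist_le R uv) rad_le.
  (* The defect in [pair_dist_eigen] is nonnegative, so the quotient of [pair_weight] is at least
     [L - 1]. *)
  rewrite mulr_sumr; apply: ler_sum => x _; rewrite eig mulrDr expr2 mulrCA lerDl.
  apply: mulr_ge0; first exact: ltW.
  apply: mulr_ge0; first by rewrite addr_ge0.
  apply: divr_ge0; last exact: ltW.
  by apply: mulr_ge0; [exact: ltW | rewrite subr_ge0].
(* By rigidity the row at [u] has no defect. *)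
have common : common_nadj R u v = n - 2 * k%:R.
  have := rowE u; rewrite eig eqxx (negbTE (adj_neq uv)) addr0 mul1r => /eqP.
  rewrite -subr_eq0 addrAC subrr add0r !mulf_eq0 invr_eq0.
  by rewrite (gt_eqF L_gt0) (gt_eqF a_gt0) orbF subr_eq0 => /eqP.
have no_common : #|[set x | [&& x != u, x != v &
    (nadj R u x == 0) && (nadj R v x == 0)]]| = 0%N.
  apply/eqP; rewrite -(eqr_nat R) -(card_nadj_union R uv du dv) common /n /c.
  by apply/eqP; ring.
apply: (special_isomorphic ST S_card T_card G_card uv du dv).
  move=> x ux; apply/negP => vx; have /eqP := no_common.
  rewrite cards_eq0 => /eqP/setP/(_ x); rewrite !inE.
  by rewrite ![x == _]eq_sym !adj_neq // !nadj_adj // eqxx.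
(* Away from [u] and [v] the entry of [pair_dist] is 1, too small for a nonadjacent pair. *)
move=> x y xy_uv xy; apply: contraTT (dist_ge_nadj R x y) => nxy.
rewrite distE -ltNge /pair_dist;
  case/and4P: xy_uv => /negbTE-> /negbTE-> /negbTE-> /negbTE->.
by rewrite !mul0r !addr0 ltrDl /nadj xy nxy ltr01.
Qed.

End Conclusion.

Theorem theorem1p3 (R : realType) (k n : nat) (G : sgraph) :
  2 <= k -> gconnected G -> #|G| = n -> 2 * k + 2 <= n -> k <= min_degree G ->
  (2 * k + 3 <= n ->
   forall S T : {set 'I_(n - 2)},
     [disjoint S & T] -> #|S| = k - 1 -> #|T| = k - 1 ->
     (dist_radius R G <= dist_radius R (F_graph S T))%R ->
     ~ isomorphic G (F_graph S T) -> k <= tau G)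
  /\
  (n = 2 * k + 2 ->
   (dist_radius R G <= (n + 1)%:R)%R ->
   ~ (exists2 H : sgraph, co_cycles n H & isomorphic G H) -> k <= tau G).
Proof.
move=> k_ge2 _ Gn n_ge /min_degree_leP deg_ge.
have n_ge' : 2 * k + 2 <= #|G| by rewrite Gn.
have pack := packing_or_count k_ge2 n_ge' deg_ge.
split=> [n_ge3 S T ST S_card T_card rad_le not_iso|nE rad_le not_co].
  case: pack => // bad.
  have [L [a [L_gt0 a_gt0 eq_sum eq_u L_lt]]] := exists_perron_pair R k_ge2 n_ge3.
  have n_gt1 : 1 < n by apply: leq_trans n_ge; rewrite addn2.
  have n_sub : n - 2 + 2 = n by rewrite subnK.
  have F_n : #|F_graph S T| = n by rewrite F_card.
  have {}rad_le : (dist_radius R G <= L - 1)%R.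
    apply: le_trans rad_le _.
    by apply: (F_dist_radius_le k_ge2 ST S_card T_card L_gt0 a_gt0); rewrite F_n.
  have [[u [v [uv du dv]]]|many] :
      (exists u v : G, [/\ adj u v, #|[set y | adj u y]| = k & #|[set y | adj v y]| =
        k])
      \/ 6 * n <= #|nonadj_pairs G| + 6 * k + 10.
    move: bad; rewrite Gn => -[special|many|many]; [by left|by right|right].
    move: (#|nonadj_pairs G|) many => m2 many.
    (* The singleton partition gives at least [(n - 1) * (n - 2 * k) + 2] missing pairs, which is
       [6 * n - 6 * k - 10] at [n = 2 * k + 3] and no less beyond. *)
    have [d nd] : exists d, n = 2 * k + 3 + d by exists (n - (2 * k + 3)); lia.
    by rewrite nd in many *; nia.
  case: not_iso.
    by apply: (special_radius_isomorphic (L := L) (a := a) (k := k) (u := u) (v := v));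
      rewrite ?Gn.
  (* The average row sum would exceed the strict bound [L_lt] on [(L - 1) * n]. *)
  have := dist_radius_average R G; rewrite Gn.
  have /(ler_wpM2r (ler0n R n)) := rad_le.
  have : (6 * n%:R <= #|nonadj_pairs G|%:R + 6 * k%:R + 10 :> R)%R.
    by rewrite -!natrM -!natrD ler_nat.
  by lra.
case: pack => // bad; case: not_co.
(* Each of the three cases makes the average degree of the complement at least 2 when
   [n = 2 * k + 2]. *)
have m2_ge : 2 * n <= #|nonadj_pairs G|.
  case: bad => [[u [v [uv du dv]]]|many|many].
  - rewrite -(ler_nat R); have := pair_count R uv du dv.
    by rewrite Gn nE natrM natrD natrM; lra.
  - by move: many; rewrite Gn; move: (#|nonadj_pairs G|) => m2; lia.
  - by move: many; rewrite Gn nE; move: (#|nonadj_pairs G|) => m2; nia.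
have sum1 : (\sum_(x : G) (1 : R) ^+ 2 = n%:R)%R.
  by under eq_bigr do rewrite expr1n; rewrite sumr_const Gn.
(* With [mu = n + 1], the row equation reads [n - 1] plus the degree in the complement equals
   [n + 1]. *)
have [||_ row] := @dist_rigidity R G (fun=> 1)%R _ _ _ (@dist_ge_nadj R G) rad_le.
- by move=> x; exact: ltr01.
- rewrite sum1 sum_dist_lower Gn.
  have : (2 * n%:R <= #|nonadj_pairs G|%:R :> R)%R by rewrite -natrM ler_nat.
  by rewrite natrD; lra.
apply: two_regular_co_cycles => // [|x]; first by rewrite nE addn2.
apply/eqP; rewrite -(eqr_nat R).
have := row x; rewrite sum_dist_lower_row Gn mulr1 natrD => rowx.
have <- : (\sum_y nadj R x y = #|[set y | (x != y) && ~~ adj x y]|%:R)%R.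
  by rewrite -natr_sum -sum1dep_card [X in _ = X%:R%R]big_mkcond.
by apply/eqP; move: rowx; lra.
Qed.
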